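(* Let $1<p,q<\infty$, and let $E_{p,q}$ denote the set of extreme contractions in $\mathcal{L}(\ell^p_2,\ell^q_2)$. (1) If $p=q=2$, or $p=2\neq q$, or $p\neq2=q$, or $1<q<2<p<\infty$, then $E_{p,q}$ is closed (in the operator norm). (2) If $p=q\neq2$, then every operator in the closure of $E_{p,p}$ that is not itself in $E_{p,p}$ is of the form $A\,\mathrm{diag}(1,s)\,B$ with $s\in\mathbb{R}$, $|s|<1$, where each of $A$ and $B$ is a product of signum matrices and permutation matrices.
   Context: All scalars are real. For $1<p<\infty$, $\ell^p_2$ denotes $\mathbb{R}^2$ with the norm $\|(x_1,x_2)\|=(|x_1|^p+|x_2|^p)^{1/p}$. $\mathcal{L}(\ell^p_2,\ell^q_2)$ is the space of linear operators from $\ell^p_2$ to $\ell^q_2$ with the operator norm; an extreme contraction is an extreme point of its closed unit ball. $\mathrm{diag}(a,b)$ is the $2\times2$ diagonal matrix with diagonal entries $a,b$. A signum matrix is a matrix $\mathrm{diag}(\varepsilon_1,\varepsilon_2)$ with $\varepsilon_1,\varepsilon_2\in\{1,-1\}$; permutation matrices are the $2\times 2$ ones. *)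

(* Defs.v *)
From HB Require Import structures.
From mathcomp Require Import all_boot all_order all_algebra all_fingroup.
From mathcomp Require Import all_classical all_reals all_analysis.

Set Implicit Arguments.
Unset Strict Implicit.
Unset Printing Implicit Defensive.

Import Order.TTheory GRing.Theory Num.Theory.

Local Open Scope classical_set_scope.
Local Open Scope ring_scope.

(* An operator R^2 -> R^2 is represented by its matrix in the standard basis,
   acting on column vectors by x |-> T *m x. *)

Definition lpnorm (R : realType) (p : R) (x : 'cV[R]_2) : R :=
  (`|x ord0 ord0| `^ p + `|x ord_max ord0| `^ p) `^ p^-1.

(* The supremum is over a nonempty bounded set of reals when 1 < p, q, so the
   default value of [sup] plays no role there. *)
Definition opnorm (R : realType) (p q : R) (T : 'M[R]_2) : R :=
  sup [set lpnorm q (T *m x) | x in [set x : 'cV[R]_2 | lpnorm p x <= 1]].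

Definition extreme_points (R : realType) (V : lmodType R) (K : set V) : set V :=
  [set x | K x /\ forall (y z : V) (t : R), K y -> K z -> 0 < t < 1 ->
             x = t *: y + (1 - t) *: z -> y = x /\ z = x].

Definition extreme_contractions (R : realType) (p q : R) : set 'M[R]_2 :=
  extreme_points [set T : 'M[R]_2 | opnorm p q T <= 1].

(* Closure for the metric induced by the operator norm; the library's topology
   on matrices comes from the entrywise sup norm instead. *)
Definition opclosure (R : realType) (p q : R) (E : set 'M[R]_2) :
    set 'M[R]_2 :=
  [set T | forall e : R, 0 < e -> exists2 S, E S & opnorm p q (T - S) < e].

Definition opclosed (R : realType) (p q : R) (E : set 'M[R]_2) : Prop :=
  opclosure p q E `<=` E.

Definition diag2 (R : realType) (a b : R) : 'M[R]_2 :=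
  diag_mx (\row_(j < 2) [:: a; b]`_j).

Definition is_signum_mx (R : realType) (A : 'M[R]_2) : Prop :=
  exists e1 e2 : R,
    [/\ e1 = 1 \/ e1 = -1, e2 = 1 \/ e2 = -1 & A = diag2 e1 e2].

Definition signum_perm_product (R : realType) (A : 'M[R]_2) : Prop :=
  exists2 s : seq 'M[R]_2,
    (forall M, M \in s -> is_signum_mx M \/ is_perm_mx M) &
    A = \prod_(M <- s) M.

(* Main.v *)
Require Import Defs.
From HB Require Import structures.
From mathcomp Require Import all_boot all_order all_algebra all_fingroup.
From mathcomp Require Import all_classical all_reals all_analysis.
From mathcomp Require Import ring lra.
Import Order.TTheory GRing.Theory Num.Theory.
Import numFieldNormedType.Exports.
Set Implicit Arguments.
Unset Strict Implicit.
Unset Printing Implicit Defensive.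
Local Open Scope classical_set_scope.
Local Open Scope ring_scope.

(** A contraction T of norm one attains its norm at a unit vector x; put
    y = T x.  The norms being smooth, T maps the tangent at x to a multiple
    lambda of the tangent at y, so T is determined by (x, y, lambda), and by
    strict convexity any segment of contractions around T only moves lambda.
    Suppose T is not extreme, so that lambda is interior to its range.  If S is
    close to T and attains its norm at a point close to x, then moving the
    parameter of S in both directions keeps it a contraction: away from that
    point by compactness, near it because the second-order comparison between
    the curvatures of the two spheres at y and x is strict and stable.  Hence S
    is not extreme either, and T is not in the closure.  The comparison is
    stable unless the curvatures at x and y are both zero (p, q > 2) or both
    infinite (p, q < 2), which forces x and y to lie on the coordinate axes;
    then T is diag(1, lambda) up to signs and permutations. *)

(** The obstacle is uniformity. A nearby [S] attains its norm at its own point, so an expansion at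
    [x] alone says nothing about [S], and on the axes the second derivative of |t|^p may be zero or
    infinite. Curvature therefore enters through one-sided quadratic bounds valid for all base
    points near a given one. Where the second derivative is finite and continuous, such a bound
    holds for every constant strictly below (or above) half of it, so one constant [c] strictly
    between the two curvatures is enough to compare the spheres. The strict gap comes from the
    perturbation. If [T + D] and [T - D] are contractions, with tangent multipliers lambda + delta
    and lambda - delta, then each multiplier m satisfies m^2 curv(y) <= curv(x). Strict convexity of
    the square makes this strict at lambda + delta/2 when curv(y) > 0. The same half step serves
    away from [x]: the midpoint of [T] and [T + D] attains norm one only on the line of [x]. *)

(** * Convexity inequalities for powers and signed powers *)

Definition psi (R : realType) (r t : R) : R := Num.sg t * `|t| `^ r.

(** The division by [p] makes the derivative exactly [psi (p - 1)]. *)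
Definition phi (R : realType) (p t : R) : R := `|t| `^ p / p.

(** Young's inequality for [b] and [a ^ (r - 1)] with the conjugate exponents r and r/(r - 1). The
    case r = 1 has no finite conjugate and is linear. *)
Lemma powR_tangent (R : realType) (r a b : R) : 1 <= r -> 0 <= a -> 0 <= b ->
  a `^ r + r * a `^ (r - 1) * (b - a) <= b `^ r.
Proof.
move=> r1 a0 b0.
have r0 : 0 < r by lra.
have [->|rne1] := eqVneq r 1.
  by rewrite subrr powRr0 !powRr1// mulr1 mul1r; lra.
have r1' : 0 < r - 1 by rewrite subr_gt0 lt_neqAle r1 andbT eq_sym.
have := @conjugate_powR _ b (a `^ (r - 1)) r (r / (r - 1)) b0 (powR_ge0 _ _) r0.
rewrite -powRrM => /(_ (divr_gt0 r0 r1')).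
have -> : (r - 1) * (r / (r - 1)) = r by field; rewrite gt_eqF.
have -> : r^-1 + (r / (r - 1))^-1 = 1.
  by field; rewrite !gt_eqF.
move=> /(_ erefl) H.
have aE := mulr_powRB1 a0 r0.
have H2 : r * (b * a `^ (r - 1)) <= b `^ r + (r - 1) * a `^ r.
  have -> : b `^ r + (r - 1) * a `^ r =
    r * (b `^ r / r + a `^ r / (r / (r - 1))).
    by field; rewrite !gt_eqF.
  by rewrite ler_pM2l.
set u := a `^ (r - 1) in aE H2 *.
rewrite -aE in H2 *; lra.
Qed.

(** The inverse power 1/r is at least 1, so its tangent inequality between [a ^ r] and [b ^ r] can
    be solved for [b ^ r]. *)
Lemma powR_cotangent (R : realType) (r a b : R) :
  0 < r -> r <= 1 -> 0 < a -> 0 <= b ->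
  b `^ r <= a `^ r + r * a `^ (r - 1) * (b - a).
Proof.
move=> r0 r1 a0 b0.
have ri1 : 1 <= r^-1 by rewrite invf_ge1.
have := @powR_tangent _ r^-1 (a `^ r) (b `^ r) ri1 (powR_ge0 _ _) (powR_ge0 _
  _).
rewrite -!powRrM divff ?gt_eqF// !powRr1 ?(ltW a0)//.
have -> : r * (r^-1 - 1) = - (r - 1) by field; rewrite gt_eqF.
rewrite powRN.
have u0 : 0 < a `^ (r - 1) by exact: powR_gt0.
set u := a `^ (r - 1) in u0 *.
move=> H.
have : r * u * (a + r^-1 / u * (b `^ r - a `^ r)) <= r * u * b.
  by rewrite ler_pM2l// mulr_gt0.
have -> : r * u * (a + r^-1 / u * (b `^ r - a `^ r)) =
  r * u * a + (b `^ r - a `^ r).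
  by field; rewrite !gt_eqF.
lra.
Qed.

Lemma bernoulli_powR (R : realType) (r u : R) : 1 <= r -> 0 <= u ->
  1 + r * u <= (1 + u) `^ r.
Proof.
move=> r1 u0; have := @powR_tangent _ r 1 (1 + u) r1 ler01 ltac:(lra).
by rewrite !powR1 mulr1 (addrC 1 u) addrK.
Qed.

Lemma bernoulli_powR_upper (R : realType) (r u : R) : 1 <= r -> 0 <= u ->
  (1 + u) `^ r <= 1 + r * u * (1 + u) `^ (r - 1).
Proof.
move=> r1 u0; have := @powR_tangent _ r (1 + u) 1 r1 ltac:(lra) ler01.
rewrite !powR1; set v := _ `^ (r - 1); lra.
Qed.

Lemma norm_powR_continuous (R : realType) (r t : R) : 0 < r \/ t != 0 ->
  {for t, continuous (fun s : R => `|s| `^ r)}.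
Proof.
move=> H.
have [t0|t0] := eqVneq t 0; last first.
  have nt0 : 0 < `|t| by rewrite normr_gt0.
  apply: (@continuous_comp _ _ _ (fun s : R => `|s|) (fun s => s `^ r)).
    exact: norm_continuous.
  apply: differentiable_continuous; apply/derivable1_diffP.
  by have [] := is_derive1_powR r nt0.
case: H => [r0|]; last by rewrite t0 eqxx.
rewrite t0; apply/cvgrPdist_lt => e e0.
rewrite normr0 powR0 ?gt_eqF//.
near=> s.
rewrite sub0r normrN ger0_norm ?powR_ge0//.
have -> : e = (e `^ r^-1) `^ r by rewrite -powRrM mulVf ?gt_eqF// powRr1 ?ltW.
apply: gt0_ltr_powR; rewrite ?nnegrE ?powR_ge0//.
near: s; apply: (@nbhs0_lt R R^o); exact: powR_gt0.
Unshelve. all: by end_near. Qed.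

Lemma cvg_norm_powR (R : realType) (I : Type) (F : set_system I) (FF : Filter F)
    (f : I -> R) (l r : R) : 0 < r \/ l != 0 ->
  f i @[i --> F] --> l -> `|f i| `^ r @[i --> F] --> `|l| `^ r.
Proof. move=> H fl; have := continuous_cvg FF (norm_powR_continuous H) fl.
exact. Qed.

(** Positive and negative parts replace the sign, which jumps at 0, so continuity of [psi] follows
    from that of powers of absolute values. *)
Lemma psi_parts (R : realType) (r t : R) : 0 < r ->
  psi r t = `|(`|t| + t) / 2| `^ r - `|(`|t| - t) / 2| `^ r.
Proof.
move=> r0; rewrite /psi; case: (ltrgt0P t) => [t0|t0|->].
- rewrite gtr0_sg// mul1r subrr mul0r normr0 powR0 ?gt_eqF// subr0.
  have -> : (t + t) / 2 = t by field.
  by rewrite gtr0_norm.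
- rewrite ltr0_sg// addNr mul0r normr0 powR0 ?gt_eqF// sub0r mulN1r.
  have -> : (- t - t) / 2 = - t by field.
  by rewrite normrN ltr0_norm.
- by rewrite sgr0 mul0r addr0 subr0 mul0r normr0 subrr.
Qed.

Lemma cvg_psi (R : realType) (I : Type) (F : set_system I) (FF : Filter F)
    (f : I -> R) (l r : R) : 0 < r ->
  f i @[i --> F] --> l -> psi r (f i) @[i --> F] --> psi r l.
Proof.
move=> r0 fl; rewrite psi_parts//.
under eq_fun do rewrite psi_parts//.
have nfl := @cvg_norm _ _ _ _ FF _ _ fl.
apply: cvgB; apply: cvg_norm_powR; (try by left).
- by apply: cvgM; [exact: cvgD|exact: cvg_cst].
- by apply: cvgM; [exact: cvgB|exact: cvg_cst].
Qed.

Lemma psiN (R : realType) (r t : R) : psi r (- t) = - psi r t.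
Proof. by rewrite /psi sgrN normrN mulNr. Qed.

Lemma psi0 (R : realType) (r : R) : psi r 0 = 0.
Proof. by rewrite /psi sgr0 mul0r. Qed.

Lemma psi_ge0E (R : realType) (r t : R) : 0 < r -> 0 <= t -> psi r t = t `^ r.
Proof.
move=> r0; rewrite le_eqVlt => /predU1P[<-|t0];
  first by rewrite psi0 powR0 ?gt_eqF.
by rewrite /psi gtr0_sg// mul1r gtr0_norm.
Qed.

Lemma psi_eq0 (R : realType) (r t : R) : (psi r t == 0) = (t == 0).
Proof. by rewrite /psi mulf_eq0 sgr_eq0 powR_eq0 normr_eq0; case: (t == 0). Qed.

Lemma mul_psi (R : realType) (p t : R) : 0 < p -> t * psi (p - 1) t = `|t| `^ p.
Proof.
by move=> p0; rewrite /psi mulrA (mulrC t) -normrEsg mulr_powRB1.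
Qed.

Lemma phi_tangent (R : realType) (p t u : R) : 1 < p ->
  phi p t + psi (p - 1) t * (u - t) <= phi p u.
Proof.
move=> p1.
have p0 : 0 < p by lra.
have := @powR_tangent _ p `|t| `|u| (ltW p1) (normr_ge0 _) (normr_ge0 _).
rewrite -(@ler_pM2r _ p^-1) ?invr_gt0//; apply: le_trans.
rewrite mulrDl lerD2l.
have -> : p * `|t| `^ (p - 1) * (`|u| - `|t|) / p =
  `|t| `^ (p - 1) * (`|u| - `|t|).
  by field; rewrite gt_eqF.
rewrite !mulrBr (mulrC _ t) (mul_psi _ p0) (mulrC _ `|t|) mulr_powRB1//.
rewrite lerD2r /psi (le_trans (ler_norm _))// !normrM normr_sg.
rewrite ger0_norm ?powR_ge0// ler_wpM2r//.
by case: (t != 0); rewrite ?mul1r// mul0r powR_ge0.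
Qed.

Lemma psi_strict_mono (R : realType) (r : R) : 0 < r ->
  {homo @psi R r : u v / u < v}.
Proof.
move=> r0 u v uv.
have [u0|u0] := leP 0 u.
  have v0 := le_trans u0 (ltW uv).
  by rewrite !psi_ge0E//; apply: gt0_ltr_powR; rewrite ?nnegrE.
have [v0|v0] := leP 0 v.
  rewrite (@lt_le_trans _ _ 0)//; last by rewrite psi_ge0E// powR_ge0.
  by rewrite -(opprK u) psiN oppr_lt0 psi_ge0E ?powR_gt0 ?oppr_gt0// oppr_ge0
    ltW.
rewrite -(opprK u) -(opprK v) psiN (psiN _ (- v)) ltrN2.
rewrite !psi_ge0E ?oppr_ge0 ?ltW//.
by apply: gt0_ltr_powR; rewrite ?nnegrE ?oppr_ge0 ?(ltW u0) ?(ltW v0)// ltrN2.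
Qed.

(** Two tangent steps through the midpoint of [t] and [u] gain the strict increase of the slope
    between them. *)
Lemma phi_tangent_strict (R : realType) (p t u : R) : 1 < p -> u != t ->
  phi p t + psi (p - 1) t * (u - t) < phi p u.
Proof.
move=> p1 ut.
have p10 : 0 < p - 1 by lra.
have H1 := @phi_tangent _ p t ((t + u) / 2) p1.
have H2 := @phi_tangent _ p ((t + u) / 2) u p1.
have H3 : psi (p - 1) t * (u - t) < psi (p - 1) ((t + u) / 2) * (u - t).
  have [tu|tu|tu] := ltgtP t u.
  - by rewrite ltr_pM2r ?subr_gt0//; apply: psi_strict_mono => //; lra.
  - by rewrite ltr_nM2r ?subr_lt0//; apply: psi_strict_mono => //; lra.
  - by rewrite tu eqxx in ut.
lra.
Qed.

(** The derivative r x^(r - 1) is monotone, so its minimum on the segment is at an end: the smaller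
    one for r >= 1, the larger one for r < 1. The tangent line there gives the bound. *)
Lemma powR_increment_lower (R : realType) (r k a b : R) :
  0 < r -> 0 < a -> 0 < b -> k <= r * a `^ (r - 1) -> k <= r * b `^ (r - 1) ->
  k * (b - a) ^+ 2 <= (b `^ r - a `^ r) * (b - a).
Proof.
move=> r0; wlog ab : a b / a <= b => [H|] a0 b0 ka kb.
  have [ab|/ltW ba] := leP a b; first exact: H.
  by have := H _ _ ba b0 a0 kb ka; lra.
rewrite expr2 mulrA ler_wpM2r ?subr_ge0//.
have [r1|r1] := leP 1 r.
  have := powR_tangent r1 (ltW a0) (ltW b0).
  have : k * (b - a) <= r * a `^ (r - 1) * (b - a)
    by rewrite ler_wpM2r ?subr_ge0.
  lra.
have := powR_cotangent r0 (ltW r1) b0 (ltW a0).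
have : k * (b - a) <= r * b `^ (r - 1) * (b - a) by rewrite ler_wpM2r ?subr_ge0.
lra.
Qed.

Lemma powR_increment_upper (R : realType) (r k a b : R) :
  0 < r -> 0 < a -> 0 < b -> r * a `^ (r - 1) <= k -> r * b `^ (r - 1) <= k ->
  (b `^ r - a `^ r) * (b - a) <= k * (b - a) ^+ 2.
Proof.
move=> r0; wlog ab : a b / a <= b => [H|] a0 b0 ka kb.
  have [ab|/ltW ba] := leP a b; first exact: H.
  by have := H _ _ ba b0 a0 kb ka; lra.
rewrite expr2 mulrA ler_wpM2r ?subr_ge0//.
have [r1|r1] := leP 1 r.
  have := powR_tangent r1 (ltW b0) (ltW a0).
  have : r * b `^ (r - 1) * (b - a) <= k * (b - a)
    by rewrite ler_wpM2r ?subr_ge0.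
  lra.
have := powR_cotangent r0 (ltW r1) a0 (ltW b0).
have : r * a `^ (r - 1) * (b - a) <= k * (b - a) by rewrite ler_wpM2r ?subr_ge0.
lra.
Qed.

(** If the signs differ, the increment splits at 0, and r <= 1 gives k a <= r a^r <= a^r on each
    half. An end at 0 is exempt from the hypothesis: for r < 1 the derivative there is infinite
    while the power of 0 is 0 by convention. *)
Lemma psi_increment_lower (R : realType) (r k t u : R) :
  0 < r -> r <= 1 \/ 0 < t * u ->
  (t != 0 -> k <= r * `|t| `^ (r - 1)) -> (u != 0 -> k <=
    r * `|u| `^ (r - 1)) ->
  k * (u - t) ^+ 2 <= (psi r u - psi r t) * (u - t).
Proof.
move=> r0; wlog tu : t u / t <= u => [H|] H0 kt ku.
  have [tu|/ltW ut] := leP t u; first exact: H.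
  by have := H _ _ ut ltac:(by rewrite mulrC) ku kt; lra.
have [t0|t0] := ltP 0 t.
  have u0 := lt_le_trans t0 tu.
  rewrite !psi_ge0E ?(ltW t0) ?(ltW u0)//; apply: powR_increment_lower => //.
    by have := kt (lt0r_neq0 t0); rewrite gtr0_norm.
  by have := ku (lt0r_neq0 u0); rewrite gtr0_norm.
have [u0|u0] := ltP u 0.
  have nt0 : 0 < - t by lra.
  have nu0 : 0 < - u by lra.
  have := @powR_increment_lower _ r k (- t) (- u) r0 nt0 nu0.
  have /kt : t != 0 by rewrite lt_eqF//; lra.
  have /ku : u != 0 by rewrite lt_eqF.
  rewrite -{1}(normrN t) -{1}(normrN u) !gtr0_norm//.
  move=> {}ku {}kt /(_ kt ku).
  have E a : 0 < - a -> psi r a = - (- a) `^ r.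
    by move=> /ltW a0; rewrite -psi_ge0E// psiN opprK.
  rewrite (E u nu0) (E t nt0) opprK.
  lra.
have r1 : 0 < t * u \/ r <= 1 by tauto.
case: r1 => [|r1]; first by rewrite ltNge mulr_le0_ge0.
rewrite expr2 mulrA ler_wpM2r ?subr_ge0//.
have K a : 0 <= a -> (a != 0 -> k <= r * `|a| `^ (r - 1)) -> k * a <= a `^ r.
  rewrite le_eqVlt => /predU1P[<- _|a0 /(_ (lt0r_neq0 a0))].
    by rewrite mulr0 powR_ge0.
  rewrite gtr0_norm// -(mulr_powRB1 (ltW a0) r0) (mulrC k) ler_pM2l// => H.
  by rewrite (le_trans H)// ler_piMl ?powR_ge0.
have := K u u0 ku.
have := K (- t) ltac:(lra); rewrite oppr_eq0 normrN => /(_ kt).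
have -> : psi r t = - (- t) `^ r by rewrite -psi_ge0E ?oppr_ge0// psiN opprK.
by rewrite psi_ge0E//; lra.
Qed.

Lemma psi_increment_upper (R : realType) (r k t u : R) :
  0 < r -> 1 <= r \/ 0 < t * u ->
  (t != 0 -> r * `|t| `^ (r - 1) <= k) -> (u != 0 -> r * `|u| `^ (r - 1) <=
    k) ->
  (psi r u - psi r t) * (u - t) <= k * (u - t) ^+ 2.
Proof.
move=> r0; wlog tu : t u / t <= u => [H|] H0 kt ku.
  have [tu|/ltW ut] := leP t u; first exact: H.
  by have := H _ _ ut ltac:(by rewrite mulrC) ku kt; lra.
have [t0|t0] := ltP 0 t.
  have u0 := lt_le_trans t0 tu.
  rewrite !psi_ge0E ?(ltW t0) ?(ltW u0)//; apply: powR_increment_upper => //.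
    by have := kt (lt0r_neq0 t0); rewrite gtr0_norm.
  by have := ku (lt0r_neq0 u0); rewrite gtr0_norm.
have [u0|u0] := ltP u 0.
  have nt0 : 0 < - t by lra.
  have nu0 : 0 < - u by lra.
  have := @powR_increment_upper _ r k (- t) (- u) r0 nt0 nu0.
  have /kt : t != 0 by rewrite lt_eqF//; lra.
  have /ku : u != 0 by rewrite lt_eqF.
  rewrite -{1}(normrN t) -{1}(normrN u) !gtr0_norm//.
  move=> {}ku {}kt /(_ kt ku).
  have E a : 0 < - a -> psi r a = - (- a) `^ r.
    by move=> /ltW a0; rewrite -psi_ge0E// psiN opprK.
  rewrite (E u nu0) (E t nt0) opprK.
  lra.
have r1 : 0 < t * u \/ 1 <= r by tauto.
case: r1 => [|r1]; first by rewrite ltNge mulr_le0_ge0.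
rewrite expr2 mulrA ler_wpM2r ?subr_ge0//.
have K a : 0 <= a -> (a != 0 -> r * `|a| `^ (r - 1) <= k) -> a `^ r <= k * a.
  rewrite le_eqVlt => /predU1P[<- _|a0 /(_ (lt0r_neq0 a0))].
    by rewrite mulr0 powR0 ?gt_eqF.
  rewrite gtr0_norm// -(mulr_powRB1 (ltW a0) r0) (mulrC k) ler_pM2l// => H.
  by rewrite (le_trans _ H)// ler_peMl ?powR_ge0.
have := K u u0 ku.
have := K (- t) ltac:(lra); rewrite oppr_eq0 normrN => /(_ kt).
have -> : psi r t = - (- t) `^ r by rewrite -psi_ge0E ?oppr_ge0// psiN opprK.
by rewrite psi_ge0E//; lra.
Qed.

(** * The derivative of [phi] and locally uniform quadratic bounds *)

(** Convexity squeezes the difference quotient between the values of [psi (p - 1)] at t and t + h.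
    This covers t = 0 without a case split. *)
Lemma is_derive_phi (R : realType) (p t : R) : 1 < p ->
  is_derive t 1 (phi p) (psi (p - 1) t).
Proof.
move=> p1.
have p10 : 0 < p - 1 by lra.
suff H : h^-1 *: (phi p (h *: 1 + t) - phi p t) @[h --> 0^'] --> psi (p - 1) t.
  by apply: DeriveDef; [apply/cvg_ex; exists (psi (p - 1) t)|exact: cvg_lim H].
have Hc : psi (p - 1) (h + t) @[h --> (0 : R)^'] --> psi (p - 1) t.
  apply: cvg_psi => //; rewrite -[X in _ --> X]add0r.
  apply: cvgD; last exact: cvg_cst.
  exact: cvg_within_filter.
apply/cvgrPdist_lt => e e0.
move/cvgrPdist_lt : Hc => /(_ _ e0) Hc.
near=> h.
have h0 : h != 0 by near: h; exact: nbhs_dnbhs_neq.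
have : `|psi (p - 1) t - psi (p - 1) (h + t)| < e by near: h.
apply: le_lt_trans.
rewrite [h *: 1]mulr1 [_ *: _]mulrC.
have H1 := @phi_tangent _ p t (h + t) p1.
have H2 := @phi_tangent _ p (h + t) t p1.
have E : phi p (h + t) - phi p t = (phi p (h + t) - phi p t) / h * h
  by rewrite mulfVK.
set q := _ / h in E *.
have H3 : psi (p - 1) t * h <= q * h by rewrite -E; lra.
have H4 : q * h <= psi (p - 1) (h + t) * h by rewrite -E; lra.
have [h_lt0|h_gt0|hE] := ltgtP h 0; last by rewrite hE eqxx in h0.
- rewrite !ler_nM2r// in H3 H4.
  by rewrite !ger0_norm; lra.
- rewrite !ler_pM2r// in H3 H4.
  by rewrite !ler0_norm; lra.
Unshelve. all: by end_near. Qed.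

(** After subtracting the linear and quadratic terms, the derivative has the sign of x - t, and the
    mean value theorem shows that the difference is least at t. *)
Lemma quadratic_lower_bound (R : realType) (f df : R -> R) (c t0 s t u : R) :
  (forall x : R, is_derive x 1 f (df x)) ->
  (forall x, `|x - t0| < s -> 2 * c * (x - t) ^+ 2 <=
    (df x - df t) * (x - t)) ->
  `|t - t0| < s -> `|u - t0| < s ->
  f t + df t * (u - t) + c * (u - t) ^+ 2 <= f u.
Proof.
move=> fdf H ts us.
pose g x := f x - c * (x - t) ^+ 2 - df t * x.
pose dg x := df x - 2 * c * (x - t) - df t.
have gdg (x : R) : is_derive x 1 g (dg x).
  have fx := fdf x.
  rewrite /g; apply: is_derive_eq.
  by rewrite /dg /GRing.scale /=; ring.
have gc a b : {within `[a, b], continuous g}.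
  apply: derivable_within_continuous => x _; exact: ex_derive.
suff : g t <= g u by rewrite /g; lra.
have [tu|ut|->] := ltgtP t u; last by [].
- have [x xtu E] := @MVT _ g dg t u tu (fun x _ => gdg x) (gc _ _).
  rewrite -subr_ge0 E mulr_ge0 ?subr_ge0 ?(ltW tu)// /dg.
  move: xtu; rewrite in_itv/= => /andP[tx xu].
  have /H : `|x - t0| < s by move: ts us;
    rewrite !ltr_norml => /andP[? ?] /andP[? ?]; apply/andP; split; lra.
  rewrite expr2 mulrA ler_pM2r ?subr_gt0//; lra.
- have [x xtu E] := @MVT _ g dg u t ut (fun x _ => gdg x) (gc _ _).
  have : g t - g u <= 0; last by lra.
  rewrite E mulr_le0_ge0 ?subr_ge0 ?(ltW ut)// /dg.
  move: xtu; rewrite in_itv/= => /andP[tx xu].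
  have /H : `|x - t0| < s by move: ts us;
    rewrite !ltr_norml => /andP[? ?] /andP[? ?]; apply/andP; split; lra.
  rewrite expr2 mulrA ler_nM2r ?subr_lt0//; lra.
Qed.

(* The second-order bounds must be uniform in the base point [t] near [t0]. *)
Definition phi_low (R : realType) (p t0 c : R) : Prop :=
  exists2 s, 0 < s & forall t u, `|t - t0| < s -> `|u - t0| < s ->
    phi p t + psi (p - 1) t * (u - t) + c * (u - t) ^+ 2 <= phi p u.

Definition phi_up (R : realType) (p t0 c : R) : Prop :=
  exists2 s, 0 < s & forall t u, `|t - t0| < s -> `|u - t0| < s ->
    phi p u <= phi p t + psi (p - 1) t * (u - t) + c * (u - t) ^+ 2.

Lemma phi_low_of_psi (R : realType) (p t0 c s : R) : 1 < p -> 0 < s ->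
  (forall t u, `|t - t0| < s -> `|u - t0| < s ->
    2 * c * (u - t) ^+ 2 <= (psi (p - 1) u - psi (p - 1) t) * (u - t)) ->
  phi_low p t0 c.
Proof.
move=> p1 s0 H; exists s => // t u ts us.
apply: (@quadratic_lower_bound _ _ _ _ t0 s) => //.
  by move=> x; exact: is_derive_phi.
by move=> x xs; exact: H.
Qed.

Lemma phi_up_of_psi (R : realType) (p t0 c s : R) : 1 < p -> 0 < s ->
  (forall t u, `|t - t0| < s -> `|u - t0| < s ->
    (psi (p - 1) u - psi (p - 1) t) * (u - t) <= 2 * c * (u - t) ^+ 2) ->
  phi_up p t0 c.
Proof.
move=> p1 s0 H; exists s => // t u ts us.
have := @quadratic_lower_bound _ (\- phi p) (\- psi (p - 1)) (- c) t0 s t u.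
rewrite /=; suff K : forall x, `|x - t0| < s -> 2 * - c * (x - t) ^+ 2 <=
  (- psi (p - 1) x - - psi (p - 1) t) * (x - t).
  move=> /(_ _ K ts us); move=> L.
  have : forall x : R, is_derive x 1 (\- phi p) (- psi (p - 1) x).
    by move=> x; have := is_derive_phi x p1 => ?; exact: is_deriveN.
  by move=> /L; lra.
by move=> x xs; have := H t x ts xs; lra.
Qed.

(* Half the second derivative of [phi p].  At 0 it is right for [2 <= p], since
   [0 `^ 0 = 1]; for [p < 2] the true value is infinite and [kappa p 0 = 0] is
   junk. *)
Definition kappa (R : realType) (p t : R) : R := (p - 1) / 2 * `|t| `^ (p - 2).

Definition regular (R : realType) (p t : R) : Prop := t != 0 \/ 2 <= p.

Lemma phi_low_le0 (R : realType) (p t c : R) : 1 < p -> c <= 0 -> phi_low p t c.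
Proof.
move=> p1 c0; exists 1 => // s u _ _.
apply: le_trans (phi_tangent s u p1).
by rewrite gerDl mulr_le0_ge0// sqr_ge0.
Qed.

Lemma kappa_ge0 (R : realType) (p t : R) : 1 < p -> 0 <= kappa p t.
Proof. by move=> p1; rewrite mulr_ge0 ?powR_ge0//; lra. Qed.

Lemma kappa_gt0 (R : realType) (p t : R) : 1 < p -> t != 0 \/ p = 2 ->
  0 < kappa p t.
Proof.
move=> p1 H; rewrite mulr_gt0//; first by lra.
case: H => [t0|->]; first by rewrite powR_gt0// normr_gt0.
by rewrite subrr powRr0.
Qed.

Lemma kappa_continuous (R : realType) (p t : R) : regular p t ->
  {for t, continuous (kappa p)}.
Proof.
move=> H; rewrite /kappa; apply: cvgM; first exact: cvg_cst.
have [p2|p2] := eqVneq p 2.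
  rewrite p2 subrr powRr0; under eq_fun do rewrite powRr0; exact: cvg_cst.
apply: norm_powR_continuous; case: H; [by right|left].
by rewrite subr_gt0 lt_neqAle eq_sym p2.
Qed.

Lemma near_same_sign (R : realType) (t0 : R) : t0 != 0 ->
  \forall t \near t0, 0 < t * t0.
Proof.
move=> tn0; have : t * t0 @[t --> t0] --> t0 * t0.
  by apply: cvgM; [exact: cvg_id|exact: cvg_cst].
by move/cvgr_gt; apply; rewrite -expr2 exprn_even_gt0.
Qed.

Lemma phi_low_kappa (R : realType) (p t0 c : R) : 1 < p -> regular p t0 ->
  c < kappa p t0 -> phi_low p t0 c.
Proof.
move=> p1 rt ct.
have [c0|c0] := leP c 0; first exact: phi_low_le0.
(* At [t0 = 0] with [2 < p] the number [kappa p t0] is 0, which leaves no room for a positive [c]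
   below it. *)
have H : t0 != 0 \/ p = 2.
  case: (eqVneq t0 0) rt ct => [->|]; last by left.
  rewrite /regular /kappa eqxx normr0 => -[//|p2].
  have [->|/eqP pn2] := eqVneq p 2; first by right.
  rewrite powR0 ?mulr0; last by apply/eqP; lra.
  by lra.
have S : \forall t \near t0, p = 2 \/ 0 < t * t0.
  case: (H) => [/near_same_sign|?]; last by apply: filterE => t; left.
  by apply: filterS => t; right.
have : \forall t \near t0, c < kappa p t /\ (p = 2 \/ 0 < t * t0).
  near=> t; split.
    by near: t; apply: (cvgr_gt _ (kappa_continuous rt)).
  by near: t.
move=> /nbhs_ballP[s /= s0 Hs].
apply: (@phi_low_of_psi _ _ _ _ s) => // t u ts us.
have {ts}[kt ht] : c < kappa p t /\ (p = 2 \/ 0 < t * t0).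
  by apply: Hs; rewrite /ball/= distrC.
have {us}[ku hu] : c < kappa p u /\ (p = 2 \/ 0 < u * t0).
  by apply: Hs; rewrite /ball/= distrC.
have E : p - 1 - 1 = p - 2 by ring.
apply: psi_increment_lower; first by lra.
- case: ht => [?|ht]; first by left; lra.
  case: hu => [?|hu]; first by left; lra.
  by right; nra.
- by rewrite E; move: kt; rewrite /kappa; lra.
- by rewrite E; move: ku; rewrite /kappa; lra.
Unshelve. all: by end_near. Qed.

Lemma phi_up_kappa (R : realType) (p t0 c : R) : 1 < p -> regular p t0 ->
  kappa p t0 < c -> phi_up p t0 c.
Proof.
move=> p1 rt ct.
have S : \forall t \near t0, 2 <= p \/ 0 < t * t0.
  case: (rt) => [/near_same_sign|?]; last by apply: filterE => t; left.
  by apply: filterS => t; right.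
have : \forall t \near t0, kappa p t < c /\ (2 <= p \/ 0 < t * t0).
  near=> t; split.
    by near: t; apply: (cvgr_lt _ (kappa_continuous rt)).
  by near: t.
move=> /nbhs_ballP[s /= s0 Hs].
apply: (@phi_up_of_psi _ _ _ _ s) => // t u ts us.
have {ts}[kt ht] : kappa p t < c /\ (2 <= p \/ 0 < t * t0).
  by apply: Hs; rewrite /ball/= distrC.
have {us}[ku hu] : kappa p u < c /\ (2 <= p \/ 0 < u * t0).
  by apply: Hs; rewrite /ball/= distrC.
have E : p - 1 - 1 = p - 2 by ring.
apply: psi_increment_upper; first by lra.
- case: ht => [?|ht]; first by left; lra.
  case: hu => [?|hu]; first by left; lra.
  by right; nra.
- by rewrite E; move: kt; rewrite /kappa; lra.
- by rewrite E; move: ku; rewrite /kappa; lra.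
Unshelve. all: by end_near. Qed.

(** The second derivative tends to infinity at 0, so it exceeds any given constant close to 0. *)
Lemma phi_low_sharp (R : realType) (p c : R) : 1 < p -> p < 2 -> phi_low p 0 c.
Proof.
move=> p1 p2.
have [c0|c0] := leP c 0; first exact: phi_low_le0.
have r0 : 0 < 2 - p by lra.
have : \forall t \near (0 : R), `|t| `^ (2 - p) < (p - 1) / (2 * c).
  have := @norm_powR_continuous _ (2 - p) (0 : R) (or_introl r0).
  move/cvgr_lt; apply; rewrite normr0 powR0 ?gt_eqF//.
  by apply: divr_gt0; lra.
move=> /nbhs_ballP[s /= s0 Hs].
have K (t : R) : `|t - 0| < s -> t != 0 -> 2 * c <=
  (p - 1) * `|t| `^ (p - 1 - 1).
  move=> ts t0.
  have /Hs : ball (0 : R) s t by rewrite /ball/= distrC.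
  have -> : p - 1 - 1 = - (2 - p) by ring.
  rewrite powRN /= ltr_pdivlMr; last by lra.
  rewrite ler_pdivlMr ?powR_gt0 ?normr_gt0//.
  by lra.
apply: (@phi_low_of_psi _ _ _ _ s) => // t u ts us.
apply: psi_increment_lower; [lra|left; lra|exact: K|exact: K].
Qed.

(** * The l^p norm of pairs and its growth along lines *)

Definition lpsum (R : realType) (p : R) (x : R * R) : R :=
  `|x.1| `^ p + `|x.2| `^ p.

Definition lp (R : realType) (p : R) (x : R * R) : R := lpsum p x `^ p^-1.

(** The derivative of [lpsum p] at [x] towards [v], divided by [p]. *)
Definition dual (R : realType) (p : R) (x v : R * R) : R :=
  psi (p - 1) x.1 * v.1 + psi (p - 1) x.2 * v.2.

Definition line (R : realType) (x v : R * R) (b : R) : R * R :=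
  (x.1 + b * v.1, x.2 + b * v.2).

Definition scale (R : realType) (a : R) (x : R * R) : R * R :=
  (a * x.1, a * x.2).

Definition cvg2 (R : realType) (I : Type) (F : set_system I) (f : I -> R * R)
    (l : R * R) : Prop :=
  ((f i).1 @[i --> F] --> l.1) /\ ((f i).2 @[i --> F] --> l.2).

(** The strict inequality leaves a margin in which the direction [v] may vary along with the base
    point. *)
Definition quad_low (R : realType) (p : R) (x v : R * R) (c : R) : Prop :=
  exists c1 c2, [/\ phi_low p x.1 c1, phi_low p x.2 c2 &
    c < c1 * v.1 ^+ 2 + c2 * v.2 ^+ 2].

Definition quad_up (R : realType) (p : R) (x v : R * R) (c : R) : Prop :=
  exists c1 c2, [/\ phi_up p x.1 c1, phi_up p x.2 c2 &
    c1 * v.1 ^+ 2 + c2 * v.2 ^+ 2 < c].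

Lemma line0 (R : realType) (x v : R * R) : line x v 0 = x.
Proof. by rewrite /line !mul0r !addr0 -surjective_pairing. Qed.

Section Norm.
Variables (R : realType) (p : R).
Hypothesis p1 : 1 < p.
Implicit Types (x v : R * R) (a : R).

Let p0 : 0 < p. Proof. exact: lt_trans p1. Qed.

Lemma lpsum_ge0 x : 0 <= lpsum p x.
Proof. by rewrite addr_ge0 ?powR_ge0. Qed.

Lemma lp_ge0 x : 0 <= lp p x.
Proof. exact: powR_ge0. Qed.

Lemma lp_powR x : lp p x `^ p = lpsum p x.
Proof. by rewrite -powRrM mulVf ?gt_eqF// powRr1// lpsum_ge0. Qed.

Lemma powRK_inv a : 0 <= a -> (a `^ p) `^ p^-1 = a.
Proof. by move=> a0; rewrite -powRrM divff ?gt_eqF// powRr1. Qed.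

Lemma lp_le x a : 0 <= a -> (lp p x <= a) = (lpsum p x <= a `^ p).
Proof.
move=> a0; apply/idP/idP => H.
  by rewrite -lp_powR; apply: ge0_ler_powR; rewrite ?nnegrE ?lp_ge0// ltW.
rewrite -(powRK_inv a0); apply: ge0_ler_powR;
  rewrite ?nnegrE ?lpsum_ge0 ?powR_ge0//.
by rewrite invr_ge0 ltW.
Qed.

Lemma lp_lt x a : 0 <= a -> (a < lp p x) = (a `^ p < lpsum p x).
Proof. by move=> a0; rewrite !ltNge lp_le. Qed.

Lemma lp_eq1 x : lpsum p x = 1 -> lp p x = 1.
Proof. by rewrite /lp => ->; rewrite powR1. Qed.

Lemma lpsum_phi x : lpsum p x = p * (phi p x.1 + phi p x.2).
Proof. by rewrite /lpsum /phi; field; rewrite gt_eqF. Qed.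

Lemma dual_self x : dual p x x = lpsum p x.
Proof. by rewrite /dual /lpsum -!mul_psi// !(mulrC (psi _ _)). Qed.

Lemma lpsum_scale a x : lpsum p (scale a x) = `|a| `^ p * lpsum p x.
Proof. by rewrite /lpsum /= !normrM !powRM// mulrDr. Qed.

Lemma lp_scale a x : lp p (scale a x) = `|a| * lp p x.
Proof.
by rewrite /lp lpsum_scale powRM ?powR_ge0 ?lpsum_ge0// powRK_inv.
Qed.

Lemma lpsum_tangent x v b :
  lpsum p x + p * (b * dual p x v) <= lpsum p (line x v b).
Proof.
rewrite !lpsum_phi -mulrDr ler_pM2l// /dual /=.
have := phi_tangent x.1 (x.1 + b * v.1) p1.
have := phi_tangent x.2 (x.2 + b * v.2) p1.
lra.
Qed.

Lemma lpsum_line_upper x v b :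
  lpsum p (line x v b) <= lpsum p x + p * (b * dual p (line x v b) v).
Proof.
have := lpsum_tangent (line x v b) v (- b).
have -> : line (line x v b) v (- b) = x.
  by rewrite (surjective_pairing x) /line /=; congr pair; ring.
lra.
Qed.

End Norm.

Lemma cvg_dual (R : realType) (p : R) (I : Type) (F : set_system I)
    (FF : Filter F) (x v : I -> R * R) (x0 v0 : R * R) : 1 < p ->
  cvg2 F x x0 -> cvg2 F v v0 -> dual p (x i) (v i) @[i --> F] --> dual p x0 v0.
Proof.
move=> p1 [x1 x2] [v1 v2].
have p10 : 0 < p - 1 by lra.
by apply: cvgD; apply: cvgM => //; apply: cvg_psi.
Qed.

Lemma cvg_line (R : realType) (I : Type) (F : set_system I)
    (FF : Filter F) (x v : I -> R * R) (x0 v0 : R * R) (b : I -> R) (b0 : R) :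
  cvg2 F x x0 -> cvg2 F v v0 -> b i @[i --> F] --> b0 ->
  cvg2 F (fun i => line (x i) (v i) (b i)) (line x0 v0 b0).
Proof.
move=> [x1 x2] [v1 v2] b_cvg.
by split; apply: cvgD => //; apply: cvgM.
Qed.

Lemma cvg_lpsum (R : realType) (p : R) (I : Type) (F : set_system I)
    (FF : Filter F) (x : I -> R * R) (x0 : R * R) : 1 < p ->
  cvg2 F x x0 -> lpsum p (x i) @[i --> F] --> lpsum p x0.
Proof.
by move=> p1 [x1 x2]; apply: cvgD; apply: cvg_norm_powR => //; left; lra.
Qed.

Lemma near_dist (R : realType) (I : Type) (F : set_system I) (FF : Filter F)
    (f : I -> R) (l s : R) : f i @[i --> F] --> l -> 0 < s ->
  \forall i \near F, `|f i - l| < s.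
Proof.
move=> /cvgrPdist_lt H s0; have := H _ s0.
by apply: filterS => i; rewrite distrC.
Qed.

Section SecondOrder.
Variables (R : realType) (p : R) (I : Type) (F : set_system I).
Context {FF : Filter F}.
Variables (x v : I -> R * R) (b : I -> R) (x0 v0 : R * R) (c : R).
Hypotheses (p1 : 1 < p) (cx : cvg2 F x x0) (cv : cvg2 F v v0).
Hypothesis (cb : b i @[i --> F] --> (0 : R)).

Let cl : cvg2 F (fun i => line (x i) (v i) (b i)) x0.
Proof.
have := cvg_line FF cx cv cb.
by rewrite line0.
Qed.

Let cvg_quad c1 c2 : c1 * (v i).1 ^+ 2 + c2 * (v i).2 ^+ 2 @[i --> F] -->
  c1 * v0.1 ^+ 2 + c2 * v0.2 ^+ 2.
Proof.
case: cv => v1 v2.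
by apply: cvgD; apply: cvgM; (try exact: cvg_cst); rewrite expr2; apply: cvgM.
Qed.

Lemma quad_low_near : quad_low p x0 v0 c -> \forall i \near F,
  lpsum p (x i) + p * (b i * dual p (x i) (v i) + c * b i ^+ 2) <=
  lpsum p (line (x i) (v i) (b i)).
Proof.
move=> [c1 [c2 [[s1 s10 H1] [s2 s20 H2] cc]]].
have p0 : 0 < p by exact: lt_trans p1.
have /cvgr_gt/(_ _ cc) N := @cvg_quad c1 c2.
near=> i.
rewrite !lpsum_phi// -mulrDr ler_pM2l// /dual /=.
have D1 : `|(x i).1 - x0.1| < s1 by near: i; apply: near_dist => //; case: cx.
have D2 : `|(x i).2 - x0.2| < s2 by near: i; apply: near_dist => //; case: cx.
have E1 : `|(line (x i) (v i) (b i)).1 - x0.1| < s1.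
  by near: i; apply: (near_dist FF (cl.1) s10).
have E2 : `|(line (x i) (v i) (b i)).2 - x0.2| < s2.
  by near: i; apply: (near_dist FF (cl.2) s20).
have K : c <= c1 * (v i).1 ^+ 2 + c2 * (v i).2 ^+ 2.
  by apply/ltW; near: i.
have := H1 _ _ D1 E1; have := H2 _ _ D2 E2; rewrite /=.
have := ler_wpM2r (sqr_ge0 (b i)) K.
lra.
Unshelve. all: by end_near. Qed.

Lemma quad_up_near : quad_up p x0 v0 c -> \forall i \near F,
  lpsum p (line (x i) (v i) (b i)) <=
  lpsum p (x i) + p * (b i * dual p (x i) (v i) + c * b i ^+ 2).
Proof.
move=> [c1 [c2 [[s1 s10 H1] [s2 s20 H2] cc]]].
have p0 : 0 < p by exact: lt_trans p1.
have /cvgr_lt/(_ _ cc) N := @cvg_quad c1 c2.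
near=> i.
rewrite !lpsum_phi// -mulrDr ler_pM2l// /dual /=.
have D1 : `|(x i).1 - x0.1| < s1 by near: i; apply: near_dist => //; case: cx.
have D2 : `|(x i).2 - x0.2| < s2 by near: i; apply: near_dist => //; case: cx.
have E1 : `|(line (x i) (v i) (b i)).1 - x0.1| < s1.
  by near: i; apply: (near_dist FF (cl.1) s10).
have E2 : `|(line (x i) (v i) (b i)).2 - x0.2| < s2.
  by near: i; apply: (near_dist FF (cl.2) s20).
have K : c1 * (v i).1 ^+ 2 + c2 * (v i).2 ^+ 2 <= c.
  by apply/ltW; near: i.
have := H1 _ _ D1 E1; have := H2 _ _ D2 E2; rewrite /=.
have := ler_wpM2r (sqr_ge0 (b i)) K.
lra.
Unshelve. all: by end_near. Qed.

End SecondOrder.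

(** The exponents p and q differ, so the two power sums cannot be compared directly. Both norms are
    compared with 1 + u, where u = c b^2: Bernoulli's inequality puts the q-norm at or below it, and
    the reverse inequality puts the p-norm strictly above it. *)
Lemma near_lp_line_lt (R : realType) (p q : R) (I : Type) (F : set_system I)
    (FF : Filter F) (x v y w : I -> R * R) (b : I -> R) (x0 v0 y0 w0 : R * R)
    (c : R) : 1 < p -> 1 < q ->
  cvg2 F x x0 -> cvg2 F v v0 -> cvg2 F y y0 -> cvg2 F w w0 ->
  b i @[i --> F] --> (0 : R) -> 0 < c ->
  quad_low p x0 v0 c -> quad_up q y0 w0 c ->
  \forall i \near F, lpsum p (x i) = 1 -> lpsum q (y i) = 1 ->
    dual p (x i) (v i) = 0 -> dual q (y i) (w i) = 0 -> b i != 0 ->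
    lp q (line (y i) (w i) (b i)) < lp p (line (x i) (v i) (b i)).
Proof.
move=> p1 q1 cx cv cy cw cb c0 qlow qup.
(* The room between [c] and [d] absorbs the factor [(1 + u) ^ (p - 1)] of the reverse Bernoulli
   inequality, which tends to 1. *)
have [d cd dlow] : exists2 d, c < d & quad_low p x0 v0 d.
  case: qlow => c1 [c2 [l1 l2 cc]].
  exists ((c + (c1 * v0.1 ^+ 2 + c2 * v0.2 ^+ 2)) / 2); first by lra.
  by exists c1, c2; split=> //; lra.
have /(_ FF) H1 := quad_low_near p1 cx cv cb dlow.
have /(_ FF) H2 := quad_up_near q1 cy cw cb qup.
have H3 : \forall i \near F, c * (1 + c * b i ^+ 2) `^ (p - 1) < d.
  have b2 : b i ^+ 2 @[i --> F] --> (0 : R).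
    by have /(_ FF) := cvgM cb cb; rewrite mulr0.
  have K1 : 1 + c * b i ^+ 2 @[i --> F] --> (1 + c * 0 : R).
    by apply: cvgD; [exact: cvg_cst|apply: cvgM => //; exact: cvg_cst].
  rewrite mulr0 addr0 in K1.
  have K : c * (`|1 + c * b i ^+ 2| `^ (p - 1)) @[i --> F] --> c * `|1| `^ (p -
    1).
    by apply: cvgM; [exact: cvg_cst|apply: cvg_norm_powR => //; left; lra].
  rewrite normr1 powR1 mulr1 in K.
  move/cvgr_lt/(_ _ cd) : K; apply: filterS => i.
  by rewrite ger0_norm// addr_ge0// mulr_ge0 ?(ltW c0)// sqr_ge0.
near=> i => xi yi xv yw bi.
have h1 : lpsum p (x i) + p * (b i * dual p (x i) (v i) + d * b i ^+ 2) <=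
  lpsum p (line (x i) (v i) (b i)) by near: i.
have h2 : lpsum q (line (y i) (w i) (b i)) <=
  lpsum q (y i) + q * (b i * dual q (y i) (w i) + c * b i ^+ 2) by near: i.
have h3 : c * (1 + c * b i ^+ 2) `^ (p - 1) < d by near: i.
rewrite xi xv mulr0 add0r in h1; rewrite yi yw mulr0 add0r in h2.
have b20 : 0 < b i ^+ 2 by rewrite exprn_even_gt0.
set u := c * b i ^+ 2 in h2 h3.
have u0 : 0 < u by rewrite mulr_gt0.
apply: (@le_lt_trans _ _ (1 + u)).
  rewrite lp_le//; last by lra.
  exact: le_trans h2 (bernoulli_powR (ltW q1) (ltW u0)).
rewrite lp_lt//; last by lra.
apply: lt_le_trans h1;
  apply: le_lt_trans (bernoulli_powR_upper (ltW p1) (ltW u0)) _.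
rewrite ltrD2l -(mulrA p u) ltr_pM2l; last by lra.
by rewrite /u mulrAC ltr_pM2r.
Unshelve. all: by end_near. Qed.

(** The preceding comparison with source and target exchanged and constant base points: for some
    small nonzero [b] the image point would be strictly longer than its source. *)
Lemma line_comparison (R : realType) (p q : R) (x v y w : R * R) (c : R) :
  1 < p -> 1 < q -> lpsum p x = 1 -> lpsum q y = 1 ->
  dual p x v = 0 -> dual q y w = 0 ->
  (forall b, lp q (line y w b) <= lp p (line x v b)) ->
  0 < c -> quad_up p x v c -> ~ quad_low q y w c.
Proof.
move=> p1 q1 ux uy xv yw H c0 qup qlow.
have C (z : R * R) : cvg2 (0 : R)^' (fun=> z) z by split; exact: cvg_cst.
have cb : b @[b --> (0 : R)^'] --> (0 : R) by exact: cvg_within.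
have := near_lp_line_lt _ q1 p1 (C y) (C w) (C x) (C v) cb c0 qlow qup.
move=> K.
have /filter_ex[b [b0 /(_ uy ux yw xv b0)]] : \forall b \near (0 :
  R)^', b != 0 /\
  (lpsum q y = 1 -> lpsum p x = 1 -> dual q y w = 0 -> dual p x v = 0 ->
    b != 0 ->
    lp p (line x v b) < lp q (line y w b)).
  by apply: filterI; [exact: (@nbhs_dnbhs_neq R)|exact: K].
by rewrite ltNge H.
Qed.

(* [dual p x] is the derivative at [x] of the l^p norm,
  so the right-hand norm is
   [1 + o(b)] while the left-hand one is at least [1 + b * dual q y w]. *)
Lemma line_first_order (R : realType) (p q : R) (x v y w : R * R) :
  1 < p -> 1 < q -> lpsum p x = 1 -> lpsum q y = 1 -> dual p x v = 0 ->
  (forall b, lp q (line y w b) <= lp p (line x v b)) -> dual q y w = 0.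
Proof.
move=> p1 q1 ux uy xv H; apply/eqP/negPn/negP => d0.
have q0 : 0 < q by lra.
set d := dual q y w in d0.
pose e (b : R) := dual p (line x v b) v.
have C (z : R * R) : cvg2 (nbhs (0 : R)) (fun=> z) z by split; exact: cvg_cst.
have cb : b @[b --> (0 : R)] --> (0 : R) by exact: cvg_id.
have ce : `|e b| @[b --> (0 : R)] --> (0 : R).
  have NF := nbhs_filter (0 : R).
  have := cvg_dual NF p1 (cvg_line NF (C x) (C v) cb) (C v).
  by rewrite line0 xv => /cvg_norm; rewrite normr0; apply.
have cu : `|e b| * (1 + `|b| * `|e b|) `^ (q - 1) @[b --> (0 : R)] --> (0 : R).
  have K : `|1 + `|b| * `|e b| | `^ (q - 1) @[b --> (0 :
    R)] --> `|1 + 0 * 0 : R| `^ (q - 1).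
    apply: cvg_norm_powR; first by left; lra.
    apply: cvgD; first exact: cvg_cst.
    apply: cvgM => //.
    by have := @norm_continuous _ R^o (0 : R); rewrite /continuous_at normr0.
  have E : (fun b => `|1 + `|b| * `|e b| | `^ (q - 1)) = fun b =>
    (1 + `|b| * `|e b|) `^ (q - 1).
    by apply/funext => b; rewrite [`|1 + _|]ger0_norm// addr_ge0// mulr_ge0.
  by rewrite E in K; have /(_ (nbhs_filter (0 : R))) := cvgM ce K;
    rewrite mul0r.
have N1 : \forall b \near (0 :
  R), `|e b| * (1 + `|b| * `|e b|) `^ (q - 1) < `|d|.
  by move/cvgr_lt : cu; apply; rewrite normr_gt0.
(* The sign of [b] is that of [d], so that the first-order term increases the norm of the image. *)
have [b [bd Hb]] : exists b, b * d = `|b| * `|d| /\ b != 0 /\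
    `|e b| * (1 + `|b| * `|e b|) `^ (q - 1) < `|d|.
  move/nbhs_ballP : N1 => [r /= r0 Hr].
  have sg1 : `|Num.sg d| = 1 by rewrite normr_sg d0.
  exists (r / 2 * Num.sg d); split; last split.
  - have -> : r / 2 * Num.sg d * d = r / 2 * `|d|
      by rewrite [`|d|]normrEsg mulrA.
    by rewrite normrM sg1 mulr1 [`|r / 2|]gtr0_norm// divr_gt0.
  - by rewrite mulf_neq0 ?sgr_eq0// gt_eqF// divr_gt0.
  apply: Hr; rewrite /ball/= sub0r normrN normrM sg1 mulr1 gtr0_norm
    ?divr_gt0//.
  by rewrite ltr_pdivrMr// ltr_pMr// ltr1n.
case: Hb => b0 Hb.
set u := `|b| * `|e b| in Hb.
have u0 : 0 <= u by rewrite mulr_ge0.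
have L1 : lp p (line x v b) <= 1 + u.
  rewrite lp_le//; last by lra.
  apply: le_trans (bernoulli_powR (ltW p1) u0).
  apply: le_trans (lpsum_line_upper p1 _ _ _) _.
  rewrite ux lerD2l ler_pM2l; last by lra.
  by rewrite /u -normrM; exact: ler_norm.
have := le_trans (H b) L1; rewrite lp_le//; last by lra.
rewrite leNgt => /negP; apply.
apply: lt_le_trans (lpsum_tangent q1 _ _ _).
apply: le_lt_trans (bernoulli_powR_upper (ltW q1) u0) _.
rewrite uy bd ltrD2l -(mulrA q u) ltr_pM2l//.
by rewrite /u -mulrA ltr_pM2l ?normr_gt0.
Qed.

(** * Operators on pairs and points where a contraction attains norm one *)

Definition app (R : realType) (T : 'M[R]_2) (z : R * R) : R * R :=
  (T ord0 ord0 * z.1 + T ord0 ord_max * z.2,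
   T ord_max ord0 * z.1 + T ord_max ord_max * z.2).

Definition contraction (R : realType) (p q : R) (T : 'M[R]_2) : Prop :=
  forall z, lp q (app T z) <= lp p z.

Definition cross (R : realType) (x z : R * R) : R := x.1 * z.2 - x.2 * z.1.

(** The gradient direction turned by a quarter turn; it spans the kernel of [dual p x] when [x] is
    nonzero. *)
Definition tangent (R : realType) (p : R) (x : R * R) : R * R :=
  (- psi (p - 1) x.2, psi (p - 1) x.1).

(* For [y] on the unit sphere of l^q, this sends [x] to [0] and, when [x] is on
   the unit sphere of l^p, [tangent p x] to [e] times [tangent q y]. *)
Definition bump (R : realType) (q e : R) (x y : R * R) : 'M[R]_2 :=
  \matrix_(i, j) (e * (if i == ord0 then (tangent q y).1 else (tangent q y).2) *
                      (if j == ord0 then - x.2 else x.1)).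

Lemma ord2P (k : 'I_2) : k = ord0 \/ k = ord_max.
Proof. by case: k => [[|[|//]] H2]; [left|right]; apply: val_inj. Qed.

Section Operators.
Variable R : realType.
Implicit Types (x y z v w : R * R) (S T D : 'M[R]_2) (p q a b e : R).

Lemma app_line T x v b : app T (line x v b) = line (app T x) (app T v) b.
Proof. by rewrite /app /line /=; congr pair; ring. Qed.

Lemma app_scale T a z : app T (scale a z) = scale a (app T z).
Proof. by rewrite /app /scale /=; congr pair; ring. Qed.

Lemma appD S T z : app (S + T) z = line (app S z) (app T z) 1.
Proof. by rewrite /app /line /= !mxE; congr pair; ring. Qed.

Lemma appB S T z : app (S - T) z = line (app S z) (app T z) (-1).
Proof. by rewrite /app /line /= !mxE; congr pair; ring. Qed.

Lemma app_bump q e x y z :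
  app (bump q e x y) z = scale (e * cross x z) (tangent q y).
Proof. by rewrite /app /bump /scale /cross !mxE /=; congr pair; ring. Qed.

Lemma app_eq0 T : (forall z, app T z = (0, 0)) -> T = 0.
Proof.
move=> H; have [a1 a2] := H (1, 0); have [b1 b2] := H (0, 1).
move: a1 a2 b1 b2; rewrite /= !mulr1 !mulr0 !addr0 !add0r => a1 a2 b1 b2.
apply/matrixP => i j; rewrite mxE.
by case: (ord2P i) => ->; case: (ord2P j) => ->.
Qed.

Lemma dual_tangent p x : dual p x (tangent p x) = 0.
Proof. by rewrite /dual /tangent /=; ring. Qed.

Lemma dual_scale p x a v : dual p x (scale a v) = a * dual p x v.
Proof. by rewrite /dual /scale /=; ring. Qed.

Lemma dual_line p x v w b : dual p x (line v w b) = dual p x v + b * dual p x w.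
Proof. by rewrite /dual /line /=; ring. Qed.

Lemma cross_tangent p x : 1 < p -> cross x (tangent p x) = lpsum p x.
Proof.
move=> p1; rewrite -dual_self// /cross /dual /tangent /=; ring.
Qed.

(** The functionals [dual p x] and [cross x] form the dual basis of [x] and [tangent p x]: each is
    [lpsum p x = 1] on its own vector and 0 on the other. *)
Lemma decomposition p x z : 1 < p -> lpsum p x = 1 ->
  z = line (scale (dual p x z) x) (tangent p x) (cross x z).
Proof.
move=> p1; rewrite -dual_self// /dual /tangent.
set s1 := psi _ _; set s2 := psi _ _ => ux.
rewrite [LHS]surjective_pairing /line /cross /scale /=; congr pair.
  by rewrite -[LHS]mul1r -ux; ring.
by rewrite -[LHS]mul1r -ux; ring.
Qed.

Lemma tangent_multiple p x w : 1 < p -> lpsum p x = 1 -> dual p x w = 0 ->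
  w = scale (cross x w) (tangent p x).
Proof.
move=> p1 ux xw; rewrite {1}(decomposition w p1 ux) xw /line /scale /=.
by congr pair; ring.
Qed.

Lemma tangent_neq0 p x a : 1 < p -> lpsum p x = 1 ->
  scale a (tangent p x) = (0, 0) -> a = 0.
Proof.
move=> p1 ux [h1 h2]; rewrite -[LHS]mulr1 -[X in _ * X]ux -(cross_tangent x p1).
have -> : a * cross x (tangent p x) =
    x.1 * (a * psi (p - 1) x.1) - x.2 * (a * - psi (p - 1) x.2).
  by rewrite /cross /=; ring.
by rewrite h1 h2; ring.
Qed.

(** Adding the tangent inequalities at y + d and y - d cancels the linear terms. A nonzero
    coordinate of [d] makes one of them strict, and the two power sums would then add up to more
    than 2. *)
Lemma lpsum_strict_convex q y d : 1 < q -> 1 <= lpsum q y ->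
  lpsum q (line y d 1) <= 1 -> lpsum q (line y d (-1)) <= 1 -> d = (0, 0).
Proof.
move=> q1 y1; have q0 : 0 < q by lra.
rewrite !lpsum_phi// => H1 H2; rewrite lpsum_phi// in y1.
have L : phi q y.1 + phi q y.2 >= q^-1 by rewrite -(ler_pM2l q0) divff ?gt_eqF.
have L1 : phi q (line y d 1).1 + phi q (line y d 1).2 <= q^-1.
  by rewrite -(ler_pM2l q0) divff ?gt_eqF.
have L2 : phi q (line y d (-1)).1 + phi q (line y d (-1)).2 <= q^-1.
  by rewrite -(ler_pM2l q0) divff ?gt_eqF.
rewrite /= in L1 L2.
have A1 := phi_tangent y.1 (y.1 + 1 * d.1) q1.
have A2 := phi_tangent y.2 (y.2 + 1 * d.2) q1.
have B1 := phi_tangent y.1 (y.1 + -1 * d.1) q1.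
have B2 := phi_tangent y.2 (y.2 + -1 * d.2) q1.
rewrite [LHS]surjective_pairing; congr pair; apply/eqP/negPn/negP => d0.
  have := @phi_tangent_strict _ q y.1 (y.1 + 1 * d.1) q1.
  have -> : y.1 + 1 * d.1 != y.1 by rewrite mul1r addrC -subr_eq0 addrK.
  move=> /(_ isT); lra.
have := @phi_tangent_strict _ q y.2 (y.2 + 1 * d.2) q1.
have -> : y.2 + 1 * d.2 != y.2 by rewrite mul1r addrC -subr_eq0 addrK.
move=> /(_ isT); lra.
Qed.

Lemma lpsum_convex q y z t : 1 < q -> 0 <= t <= 1 -> lpsum q y <= 1 ->
  lpsum q z <= 1 -> lpsum q (line (scale t y) z (1 - t)) <= 1.
Proof.
move=> q1 /andP[t0 t1]; have q0 : 0 < q by lra.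
have C (u v : R) : phi q (t * u + (1 - t) * v) <=
  t * phi q u + (1 - t) * phi q v.
  set m := t * u + (1 - t) * v.
  have := ler_wpM2l t0 (phi_tangent m u q1).
  have /ler_wpM2l/(_ _ _ (phi_tangent m v q1)) : 0 <= 1 - t by lra.
  have : t * (psi (q - 1) m * (u - m)) + (1 - t) * (psi (q - 1) m * (v - m)) =
    0.
    by rewrite /m; ring.
  lra.
rewrite !lpsum_phi// => H1 H2.
have K (u v : R) : q * (phi q u + phi q v) <= 1 -> phi q u + phi q v <= q^-1.
  by move=> H; rewrite -(ler_pM2l q0) divff ?gt_eqF.
rewrite -[leRHS](divff (lt0r_neq0 q0)) ler_pM2l//=.
have := C y.1 z.1; have := C y.2 z.2.
have := ler_wpM2l t0 (K _ _ H1).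
have /ler_wpM2l/(_ _ _ (K _ _ H2)) : 0 <= 1 - t by lra.
lra.
Qed.

Lemma contraction_unit p q T : 1 < p -> 1 < q ->
  (forall z, lpsum p z = 1 -> lpsum q (app T z) <= 1) -> contraction p q T.
Proof.
move=> p1 q1 H z.
have p0 : p != 0 by rewrite gt_eqF//; lra.
have q0 : q != 0 by rewrite gt_eqF//; lra.
have [z0|z0] := eqVneq (lpsum p z) 0.
  have : z = (0, 0).
    move: z0 => /eqP; rewrite paddr_eq0 ?powR_ge0// !powR_eq0 !normr_eq0 p0
      !andbT.
    by rewrite [z]surjective_pairing /= => /andP[/eqP-> /eqP->].
  move=> ->; rewrite /app /= !mulr0 addr0 /lp /lpsum /= normr0 !powR0// addr0.
  by rewrite !powR0 ?invr_eq0.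
have m0 : 0 < lp p z by rewrite powR_gt0// lt_neqAle eq_sym z0 lpsum_ge0.
set m := lp p z in m0 *.
have E : z = scale m (scale m^-1 z).
  by rewrite [LHS]surjective_pairing /scale /= !mulVKf ?gt_eqF.
have u1 : lpsum p (scale m^-1 z) = 1.
  rewrite lpsum_scale// gtr0_norm ?invr_gt0// -lp_powR// -/m.
  rewrite -powRM ?invr_ge0 ?(ltW m0)// mulVf ?gt_eqF// powR1//.
rewrite E app_scale lp_scale// gtr0_norm// -[leRHS]mulr1 ler_pM2l//.
by rewrite lp_le// powR1; exact: H.
Qed.

Lemma contraction_lpsum p q T z : 1 < p -> 1 < q ->
  contraction p q T -> lpsum p z = 1 -> lpsum q (app T z) <= 1.
Proof.
move=> p1 q1 cT uz; have := cT z.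
by rewrite (lp_eq1 uz) lp_le// powR1.
Qed.

Lemma contraction_convex p q S T t : 1 < p -> 1 < q -> 0 <= t <= 1 ->
  contraction p q S -> contraction p q T ->
  contraction p q (t *: S + (1 - t) *: T).
Proof.
move=> p1 q1 t01 cS cT; apply: contraction_unit => // z uz.
have -> : app (t *: S + (1 - t) *: T) z =
  line (scale t (app S z)) (app T z) (1 - t).
  by rewrite /app /line /scale /= !mxE; congr pair; ring.
by apply: lpsum_convex => //;
  [exact: contraction_lpsum p1 q1 cS uz|exact: contraction_lpsum p1 q1 cT uz].
Qed.

Lemma perturbation_kernel p q T D x : 1 < p -> 1 < q ->
  contraction p q (T + D) -> contraction p q (T - D) ->
  lpsum p x = 1 -> lpsum q (app T x) = 1 -> app D x = (0, 0).
Proof.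
move=> p1 q1 c1 c2 ux uy; apply: (@lpsum_strict_convex q (app T x)) => //.
- by rewrite uy.
- by rewrite -appD; exact: (contraction_lpsum p1 q1 c1 ux).
- by rewrite -appB; exact: (contraction_lpsum p1 q1 c2 ux).
Qed.

Lemma contraction_tangent p q T x : 1 < p -> 1 < q -> contraction p q T ->
  lpsum p x = 1 -> lpsum q (app T x) = 1 ->
  dual q (app T x) (app T (tangent p x)) = 0.
Proof.
move=> p1 q1 cT ux uy.
apply: (line_first_order p1 q1 ux uy (dual_tangent p x)) => b.
by rewrite -app_line; exact: cT.
Qed.

End Operators.

(** * Curvature of the unit sphere *)

Section Curvature.
Variables (R : realType) (p : R) (x : R * R).
Hypotheses (p1 : 1 < p) (ux : lpsum p x = 1).
Implicit Types (v : R * R) (c e : R).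

(* At the points of the coordinate axes the unit sphere of l^p has infinite
   curvature if [p < 2] (sharp) and zero curvature if [2 < p] (flat). *)
Definition sharp : Prop := p < 2 /\ (x.1 = 0 \/ x.2 = 0).

Definition flat : Prop := 2 < p /\ (x.1 = 0 \/ x.2 = 0).

(** Half the second derivative along [v] of [lpsum p] divided by [p]. At a sharp point it inherits
    the junk value of [kappa], so it is only compared at points that are not sharp. *)
Definition curvature v : R := kappa p x.1 * v.1 ^+ 2 + kappa p x.2 * v.2 ^+ 2.

Lemma curvature_scale e v : curvature (scale e v) = e ^+ 2 * curvature v.
Proof. by rewrite /curvature /scale /=; ring. Qed.

Lemma curvature_ge0 v : 0 <= curvature v.
Proof. by rewrite addr_ge0// mulr_ge0 ?sqr_ge0 ?kappa_ge0. Qed.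

Lemma not_sharp_regular : ~ sharp -> regular p x.1 /\ regular p x.2.
Proof.
move=> ns; have [p2|p2] := leP 2 p; first by split; right.
by split; left; apply/eqP => x0; apply: ns; split=> //; [left|right].
Qed.

Lemma not_sharp_quad_low v c : ~ sharp -> c < curvature v -> quad_low p x v c.
Proof.
move=> /not_sharp_regular[r1 r2] cv.
(* Lowering both coefficients by [d] costs less than half of the gap; the summand 1 keeps the
   denominator positive when [v] is zero. *)
pose d := (curvature v - c) / (2 * (1 + v.1 ^+ 2 + v.2 ^+ 2)).
have n0 : 0 < 1 + v.1 ^+ 2 + v.2 ^+ 2
  by rewrite -addrA ltr_pwDl// addr_ge0 ?sqr_ge0.
have d0 : 0 < d by rewrite divr_gt0//; lra.
exists (kappa p x.1 - d), (kappa p x.2 - d); split.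
- by apply: phi_low_kappa => //; lra.
- by apply: phi_low_kappa => //; lra.
have : d * (2 * (1 + v.1 ^+ 2 + v.2 ^+ 2)) = curvature v - c.
  by rewrite /d divfK// gt_eqF// mulr_gt0.
by move: cv; rewrite /curvature; lra.
Qed.

Lemma not_sharp_quad_up v c : ~ sharp -> curvature v < c -> quad_up p x v c.
Proof.
move=> /not_sharp_regular[r1 r2] cv.
pose d := (c - curvature v) / (2 * (1 + v.1 ^+ 2 + v.2 ^+ 2)).
have n0 : 0 < 1 + v.1 ^+ 2 + v.2 ^+ 2
  by rewrite -addrA ltr_pwDl// addr_ge0 ?sqr_ge0.
have d0 : 0 < d by rewrite divr_gt0//; lra.
exists (kappa p x.1 + d), (kappa p x.2 + d); split.
- by apply: phi_up_kappa => //; lra.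
- by apply: phi_up_kappa => //; lra.
have : d * (2 * (1 + v.1 ^+ 2 + v.2 ^+ 2)) = c - curvature v.
  by rewrite /d divfK// gt_eqF// mulr_gt0.
by move: cv; rewrite /curvature; lra.
Qed.

Lemma coordinate_neq0 : x.1 != 0 \/ x.2 != 0.
Proof.
have [x1|] := eqVneq x.1 0; last by left.
right; apply/eqP => x2; move: ux; rewrite /lpsum x1 x2 normr0 powR0.
  by rewrite addr0 => /esym/eqP; rewrite oner_eq0.
by rewrite gt_eqF// (lt_trans ltr01).
Qed.

(** On an axis the tangent points along the vanishing coordinate, where every constant is
    admissible; the other coordinate contributes the constant 0. *)
Lemma sharp_quad_low e c : sharp -> e != 0 ->
  quad_low p x (scale e (tangent p x)) c.
Proof.
move=> [p2 x0] e0.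
have K (m : R) : m != 0 -> exists c1, c < c1 * m ^+ 2.
  move=> m0; exists ((c + 1) / m ^+ 2).
  by rewrite divfK ?sqrf_eq0//; lra.
have [x10|x10] := eqVneq x.1 0.
  have [x1|x20] := coordinate_neq0; first by rewrite x10 eqxx in x1.
  have [c1 c1P] : exists c1, c < c1 * (e * - psi (p - 1) x.2) ^+ 2.
    by apply: K; rewrite mulf_neq0// oppr_eq0 psi_eq0.
  exists c1, 0; split; [rewrite x10; exact: phi_low_sharp|exact: phi_low_le0|].
  by rewrite mul0r addr0.
have x20 : x.2 = 0 by case: x0 => // /eqP; rewrite (negbTE x10).
have [c1 c1P] : exists c1, c < c1 * (e * psi (p - 1) x.1) ^+ 2.
  by apply: K; rewrite mulf_neq0// psi_eq0.
exists 0, c1; split; [exact: phi_low_le0|rewrite x20; exact: phi_low_sharp|].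
by rewrite mul0r add0r.
Qed.

Lemma curvature_gt0 : ~ sharp -> ~ flat -> 0 < curvature (tangent p x).
Proof.
move=> ns nf.
have H : p = 2 \/ (x.1 != 0 /\ x.2 != 0).
  have [p2|p2|] := ltgtP p 2; last by left.
  - by right; split; apply/eqP => x0; apply: ns; split=> //; [left|right].
  - by right; split; apply/eqP => x0; apply: nf; split=> //; [left|right].
have k1 : 0 < kappa p x.1 by apply: kappa_gt0 => //; case: H => [|[]];
  [right|left].
have k2 : 0 < kappa p x.2 by apply: kappa_gt0 => //; case: H => [|[]];
  [right|left].
rewrite /curvature /tangent /=.
have S1 := sqr_ge0 (- psi (p - 1) x.2); have S2 := sqr_ge0 (psi (p - 1) x.1).
have [x1|x2] := coordinate_neq0.
  apply: ltr_wpDl; first by rewrite mulr_ge0// ltW.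
  by rewrite mulr_gt0// exprn_even_gt0//= psi_eq0.
apply: ltr_wpDr; first by rewrite mulr_ge0// ltW.
by rewrite mulr_gt0// exprn_even_gt0//= oppr_eq0 psi_eq0.
Qed.

End Curvature.

(** * Compactness of the sphere and limits *)

(** The compact square [-1, 1]^2 contains the sphere. A point of the square off the sphere has a
    neighbourhood missing it, where the condition is vacuous. *)
Lemma sphere_near_covering (R : realType) (p : R) (I : Type) (F : set_system I)
    (FF : Filter F) (P : I -> R * R -> Prop) : 1 < p ->
  (forall z : R * R, lpsum p z = 1 ->
     \forall z' \near z & i \near F, lpsum p z' = 1 -> P i z') ->
  \forall i \near F, forall z, lpsum p z = 1 -> P i z.
Proof.
move=> p1 H.
have cK := compact_setX (@segment_compact R (-1) 1) (@segment_compact R (-1) 1).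
move/compact_near_coveringP : cK => /(_ _ F (fun i z =>
  lpsum p z = 1 -> P i z) FF).
have c2 (z : R * R) : cvg2 (nbhs z) id z by split;
  [exact: cvg_fst|exact: cvg_snd].
have K : forall z : R * R, (`[-1, 1] `*` `[-1, 1]) z ->
    \forall z' \near z & i \near F, lpsum p z' = 1 -> P i z'.
  move=> z _; have [/H //|/eqP z1] := pselect (lpsum p z = 1).
  have cz := cvg_lpsum (nbhs_filter z) p1 (c2 z).
  have /near_dist := cz; move=> /(_ `|lpsum p z - 1|).
  rewrite normr_gt0 subr_eq0 => /(_ z1) N.
  exists ([set z' | `|lpsum p z' - lpsum p z| < `|lpsum p z - 1|], setT) => /=.
    by split; [exact: N|exact: filterT].
  move=> [z' i] /= [h _] h1; move: h; rewrite h1 distrC.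
  by rewrite ltxx.
move=> /(_ K); apply: filterS => i H1 z uz; apply: H1 (uz).
have p0 : 0 < p by exact: lt_trans p1.
have B (a b : R) : `|a| `^ p + `|b| `^ p = 1 -> -1 <= a <= 1.
  move=> ab; rewrite -ler_norml.
  have : `|a| `^ p <= 1 `^ p by rewrite powR1 -ab lerDl powR_ge0.
  rewrite leNgt => /negP h; rewrite leNgt; apply/negP => a1; apply: h.
  by apply: gt0_ltr_powR; rewrite ?nnegrE.
by split; rewrite /= in_itv /=; [exact: B uz|rewrite /lpsum addrC in uz;
  exact: B uz].
Qed.

Lemma line_zero (R : realType) (x : R * R) b : line x (0, 0) b = x.
Proof. by rewrite /line /= mulr0 !addr0 -surjective_pairing. Qed.

Lemma line_scale (R : realType) (x : R * R) (s t b : R) :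
  line (scale s x) (scale t x) b = scale (s + b * t) x.
Proof. by rewrite /line /scale /=; congr pair; ring. Qed.

Lemma line_line (R : realType) (x d : R * R) (s t b : R) :
  line (line x d s) (scale t d) b = line x d (s + b * t).
Proof. by rewrite /line /scale /=; congr pair; ring. Qed.

Definition mx_cvg (R : realType) (I : Type) (F : set_system I) (S : I ->
  'M[R]_2)
  (T : 'M[R]_2) : Prop := forall k l, S i k l @[i --> F] --> T k l.

Lemma cvg2_fst (R : realType) (I : Type) (F : set_system I) (FF : Filter F)
    (z : R * R) : cvg2 (filter_prod (nbhs z) F) fst z.
Proof.
by split; apply: cvg_comp;
  [exact: cvg_fst|exact: cvg_fst|exact: cvg_fst|exact: cvg_snd].
Qed.

Section Limits.
Variables (R : realType) (I : Type) (F : set_system I).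
Context {FF : Filter F}.

Lemma cvg_app (S : I -> 'M[R]_2) T (z : I -> R * R) z0 :
  mx_cvg F S T -> cvg2 F z z0 -> cvg2 F (fun i => app (S i) (z i)) (app T z0).
Proof.
by move=> ST [z1 z2]; split; apply: cvgD; apply: cvgM => //; exact: ST.
Qed.

Lemma cvg_tangent (q : R) (y : I -> R * R) y0 : 1 < q ->
  cvg2 F y y0 -> cvg2 F (fun i => tangent q (y i)) (tangent q y0).
Proof.
move=> q1 [c1 c2]; have q0 : 0 < q - 1 by lra.
by split; [apply: cvgN|]; apply: cvg_psi.
Qed.

Lemma cvg_cross (x z : I -> R * R) x0 z0 : cvg2 F x x0 -> cvg2 F z z0 ->
  cross (x i) (z i) @[i --> F] --> cross x0 z0.
Proof. by move=> [x1 x2] [z1 z2]; apply: cvgB; apply: cvgM. Qed.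

Lemma cvg_scale (a : I -> R) (x : I -> R * R) a0 x0 : a i @[i --> F] --> a0 ->
  cvg2 F x x0 -> cvg2 F (fun i => scale (a i) (x i)) (scale a0 x0).
Proof. by move=> ca [x1 x2]; split; apply: cvgM. Qed.

End Limits.

(** * Two-sided perturbations of a contraction at a norming point *)

Section Perturbation.
Variables (R : realType) (p q : R) (T D : 'M[R]_2) (x0 : R * R).
Hypotheses (p1 : 1 < p) (q1 : 1 < q).
Hypotheses (cD : contraction p q (T + D)) (cND : contraction p q (T - D)).
Hypothesis cT : contraction p q T.
Let y0 := app T x0.
Hypotheses (ux : lpsum p x0 = 1) (uy : lpsum q y0 = 1).

Let v0 := tangent p x0.
Let lambda := cross y0 (app T v0).
Let delta := cross y0 (app D v0).

Let Dx0 : app D x0 = (0, 0).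
Proof. exact: perturbation_kernel p1 q1 cD cND ux uy. Qed.

Lemma tangent_image : app T v0 = scale lambda (tangent q y0).
Proof.
by apply: tangent_multiple => //; exact: contraction_tangent p1 q1 cT ux uy.
Qed.

(** [T + D] also sends [x0] to [y0], so it obeys the same first-order condition as [T]; the
    difference of the two conditions concerns [D] alone. *)
Lemma tangent_perturbation : app D v0 = scale delta (tangent q y0).
Proof.
apply: tangent_multiple => //.
have xE : app (T + D) x0 = y0.
  by rewrite appD Dx0 line_zero.
have := contraction_tangent p1 q1 cD ux; rewrite xE => /(_ uy).
rewrite appD dual_line mul1r.
by rewrite (contraction_tangent p1 q1 cT ux uy) add0r.
Qed.

(** Thus [D] acts as the rank-one operator [bump q delta x0 y0], which is the model for perturbing
    the nearby [S]. *)
Lemma perturbation_app z : app D z = scale (delta * cross x0 z) (tangent q y0).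
Proof.
rewrite {1}(decomposition z p1 ux) app_line app_scale Dx0 tangent_perturbation.
by rewrite /line /scale /=; congr pair; ring.
Qed.

Lemma delta_neq0 : D != 0 -> delta != 0.
Proof.
move=> D0; apply: contraNneq D0 => d0; apply/eqP/app_eq0 => z.
by rewrite perturbation_app d0 /scale !mul0r.
Qed.

(** With half of [delta] the perturbed operators tend to [T + D / 2], the midpoint of two
    contractions, to which strict convexity applies. The opposite perturbation comes from the same
    lemma for [- D]. *)
Lemma near_bump_contraction (I : Type) (F : set_system I) (FF : Filter F)
    (S : I -> 'M[R]_2) (x : I -> R * R) (c : R) : delta != 0 -> 0 < c ->
  quad_low p x0 v0 c ->
  quad_up q y0 (scale (lambda + delta / 2) (tangent q y0)) c ->
  mx_cvg F S T -> cvg2 F x x0 ->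
  \forall i \near F, contraction p q (S i) -> lpsum p (x i) = 1 ->
    lpsum q (app (S i) (x i)) = 1 ->
    contraction p q (S i + bump q (delta / 2) (x i) (app (S i) (x i))).
Proof.
move=> d0 c0 qlow qup cS cx.
pose P i z := contraction p q (S i) -> lpsum p (x i) = 1 ->
    lpsum q (app (S i) (x i)) = 1 ->
    lpsum q (app (S i + bump q (delta / 2) (x i) (app (S i) (x i))) z) <= 1.
suff : \forall i \near F, forall z, lpsum p z = 1 -> P i z.
  apply: filterS => i H cSi xi yi; apply: contraction_unit => // z uz; exact: H.
apply: sphere_near_covering => // z uz.
pose G := filter_prod (nbhs z) F.
have FG : Filter G by exact: filter_prod_filter.
have cz : cvg2 G fst z by exact: cvg2_fst.
have cS' : mx_cvg G (S \o snd) T.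
  by move=> k l; exact: (cvg_comp _ _ (@cvg_snd _ _ _ _ _) (cS k l)).
have cx' : cvg2 G (x \o snd) x0.
  by case: cx => x1 x2; split; [exact: (cvg_comp _ _ (@cvg_snd _ _ _ _ _) x1)|
                                exact: (cvg_comp _ _ (@cvg_snd _ _ _ _ _) x2)].
pose y (j : (R * R) * I) := app (S j.2) (x j.2).
have cy : cvg2 G y y0 by exact: cvg_app cS' cx'.
pose v (j : (R * R) * I) := tangent p (x j.2).
have cv : cvg2 G v v0 by exact: (cvg_tangent p1 cx').
pose w (j : (R * R) * I) :=
  line (app (S j.2) (v j)) (tangent q (y j)) (delta / 2).
have cw : cvg2 G w (scale (lambda + delta / 2) (tangent q y0)).
  have -> : scale (lambda + delta / 2) (tangent q y0) =
      line (app T v0) (tangent q y0) (delta / 2).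
    by rewrite tangent_image /line /scale /=; congr pair; ring.
  apply: cvg_line; [exact: cvg_app cS' cv|exact: (cvg_tangent q1 cy)|exact:
    cvg_cst].
pose b (j : (R * R) * I) := cross (x j.2) j.1.
have cb : b j @[j --> G] --> cross x0 z by exact: cvg_cross cx' cz.
pose a (j : (R * R) * I) := dual p (x j.2) j.1.
have ca : a j @[j --> G] --> dual p x0 z by exact: cvg_dual p1 cx' cz.
have appE j : lpsum p (x j.2) = 1 ->
    app (S j.2 + bump q (delta / 2) (x j.2) (app (S j.2) (x j.2))) j.1 =
    line (scale (a j) (y j)) (w j) (b j).
  move=> xj.
  rewrite appD app_bump [in app (S j.2) j.1](decomposition j.1 p1 xj).
  rewrite app_line app_scale -/(v j) -/(y j) -/(a j) -/(b j).
  by rewrite /w /line /scale /=; congr pair; ring.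
pose l := line (scale (dual p x0 z) y0) (scale (lambda + delta / 2) (tangent q
  y0)) (cross x0 z).
have cl : cvg2 G (fun j => line (scale (a j) (y j)) (w j) (b j)) l.
  by apply: cvg_line => //; exact: cvg_scale.
have lE : l = line (app T z) (app D z) (1 / 2).
  rewrite perturbation_app [in app T z](decomposition z p1 ux) app_line
    app_scale.
  by rewrite -/v0 tangent_image /l /line /scale /=; congr pair; ring.
(* By strict convexity the limit operator attains its norm only at [x0] and
   [- x0]; there the second-order comparison is needed. *)
have [l1|l1] := ltP (lpsum q l) 1.
  have /cvgr_lt/(_ _ l1) := cvg_lpsum FG q1 cl.
  apply: filterS => -[z' i] /= H uz' cSi xi yi.
  by rewrite (appE (z', i) xi); exact: ltW.
have Dz : scale (1 / 2) (app D z) = (0, 0).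
  apply: (lpsum_strict_convex q1 l1).
  - have -> : line l (scale (1 / 2) (app D z)) 1 = app (T + D) z.
      rewrite lE line_line appD; congr (line _ _ _); lra.
    exact: contraction_lpsum p1 q1 cD uz.
  - have -> : line l (scale (1 / 2) (app D z)) (-1) = app T z.
      by rewrite lE line_line mulN1r subrr line0.
    exact: contraction_lpsum p1 q1 cT uz.
have b0 : cross x0 z = 0.
  have : scale (1 / 2 * (delta * cross x0 z)) (tangent q y0) = (0, 0).
    by rewrite -Dz perturbation_app /scale /=; congr pair; ring.
  move=> /(tangent_neq0 q1 uy) /eqP; rewrite !mulf_eq0 (negbTE d0) /=.
  by rewrite oner_eq0 invr_eq0 pnatr_eq0 /= => /eqP.
have a0 : dual p x0 z != 0.
  apply/eqP => a0; move: uz; rewrite (decomposition z p1 ux) a0 b0 line0.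
  rewrite lpsum_scale// normr0 powR0 ?mul0r;
    last by rewrite gt_eqF ?(lt_trans ltr01).
  by move=> /esym/eqP; rewrite oner_eq0.
(* By homogeneity the point may be divided by its coefficient [a], which is nonzero near [z]. It
   then lies on the tangent line at distance parameter b/a tending to 0. *)
have cba : b j / a j @[j --> G] --> (0 : R).
  have : b j / a j @[j --> G] --> cross x0 z / dual p x0 z.
    by apply: cvgM => //; apply: cvgV.
  by rewrite b0 mul0r.
have N1 := near_lp_line_lt FG p1 q1 cx' cv cy cw cba c0 qlow qup.
have N2 : \forall j \near G, 0 < a j * dual p x0 z.
  have : a j * dual p x0 z @[j --> G] --> dual p x0 z * dual p x0 z.
    by apply: cvgM => //; exact: cvg_cst.
  by move/cvgr_gt; apply; rewrite -expr2 exprn_even_gt0.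
move: (@filterI _ _ FG _ _ N1 N2);
  apply: filterS => -[z' i] /= [H H0] uz' cSi xi yi.
rewrite (appE (z', i) xi).
have aj0 : a (z', i) != 0 by apply: contraTneq H0 => ->; rewrite mul0r ltxx.
set j := (z', i) in H aj0 *.
have lw u u' : line (scale (a j) u) u' (b j) =
  scale (a j) (line u u' (b j / a j)).
  by rewrite /line /scale /=; congr pair; field.
have zE : z' = scale (a j) (line (x i) (v j) (b j / a j)).
  by rewrite -lw [LHS](decomposition z' p1 xi).
have := lp_eq1 uz'; rewrite {1}zE lp_scale// lw => uz1.
have : lp q (scale (a j) (line (y j) (w j) (b j / a j))) <= 1.
  rewrite (lp_scale q1) -[leRHS]uz1 ler_pM2l; last by rewrite normr_gt0.
  (* At ratio 0 the strict comparison says nothing, but both points are then unit vectors. *)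
  have [->|bj0] := eqVneq (b j / a j) 0.
    by rewrite !line0 (lp_eq1 xi) (lp_eq1 yi).
  apply/ltW/H => //; first exact: dual_tangent.
  rewrite /w dual_line dual_tangent mulr0 addr0.
  exact: contraction_tangent p1 q1 cSi xi yi.
by rewrite lp_le// powR1.
Qed.

(** Since [delta] is nonzero, [T + D] or [T - D] has a nonzero multiplier. Along its image line the
    norm grows faster than any multiple of b^2, whereas at a non-sharp [x0] the growth is at most
    quadratic. *)
Lemma perturbed_sharp : D != 0 -> sharp q y0 -> sharp p x0.
Proof.
move=> /delta_neq0 d0 sy; apply: contrapT => nsx.
have [c c0 qup] : exists2 c, 0 < c & quad_up p x0 v0 c.
  exists (curvature p x0 v0 + 1); first by rewrite ltr_wpDl// curvature_ge0.
  by apply: not_sharp_quad_up => //; rewrite ltrDl.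
have [E [cE [m m0 xvE]]] : exists E, contraction p q E /\
    exists2 m, m != 0 & app E x0 = y0 /\ app E v0 = scale m (tangent q y0).
  have [l0|l0] := eqVneq (lambda + delta) 0.
    exists (T - D); split=> //; exists (lambda - delta).
      by apply: contraNneq d0 => l1; apply/eqP; lra.
    rewrite !appB Dx0 tangent_perturbation tangent_image line_zero line_scale.
    by rewrite mulN1r.
  exists (T + D); split=> //; exists (lambda + delta) => //.
  rewrite !appD Dx0 tangent_perturbation tangent_image line_zero line_scale.
  by rewrite mul1r.
case: xvE => xE vE.
apply: (line_comparison p1 q1 ux uy (dual_tangent p x0) _ _ c0 qup
          (sharp_quad_low q1 uy c sy m0)).
  by rewrite dual_scale dual_tangent mulr0.
by move=> b; rewrite -vE -xE -app_line; exact: cE.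
Qed.

Lemma curvature_comparison m E : ~ sharp p x0 -> ~ sharp q y0 ->
  contraction p q E -> app E x0 = y0 -> app E v0 = scale m (tangent q y0) ->
  m ^+ 2 * curvature q y0 (tangent q y0) <= curvature p x0 v0.
Proof.
move=> nsx nsy cE xE vE; rewrite -curvature_scale leNgt; apply/negP => H.
pose c := (curvature p x0 v0 + curvature q y0 (scale m (tangent q y0))) / 2.
have c0 : 0 < c.
  by rewrite divr_gt0//; have := curvature_ge0 x0 p1 v0; lra.
have := @line_comparison R p q x0 v0 y0 (scale m (tangent q y0)) c p1 q1 ux uy.
apply.
- exact: dual_tangent.
- by rewrite dual_scale dual_tangent mulr0.
- by move=> b; rewrite -vE -xE -app_line; exact: cE.
- exact: c0.
- by apply: (not_sharp_quad_up p1 nsx); rewrite /c; lra.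
- by apply: (not_sharp_quad_low q1 nsy); rewrite /c; lra.
Qed.

(** A sharp [y0] would force a sharp [x0], which is excluded, and a sharp [x0] admits every
    constant. Otherwise [c] is the mean of two curvatures that are shown to differ strictly. *)
Lemma quadratic_gap : D != 0 ->
  ~ (flat p x0 /\ flat q y0) -> ~ (sharp p x0 /\ sharp q y0) ->
  exists2 c, 0 < c & quad_low p x0 v0 c /\
    quad_up q y0 (scale (lambda + delta / 2) (tangent q y0)) c.
Proof.
move=> D0 nff nss.
have nsy : ~ sharp q y0 by move=> sy; apply: nss; split=> //;
  exact: perturbed_sharp.
set w := scale _ _.
have [sx|nsx] := pselect (sharp p x0).
  exists (curvature q y0 w + 1); first by rewrite ltr_wpDl// curvature_ge0.
  split; last by apply: not_sharp_quad_up => //; rewrite ltrDl.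
  have := sharp_quad_low p1 ux (curvature q y0 w + 1) sx (oner_neq0 R).
  by rewrite /scale !mul1r -surjective_pairing.
have d0 := delta_neq0 D0.
have K1 : (lambda + delta) ^+ 2 * curvature q y0 (tangent q y0) <=
  curvature p x0 v0.
  apply: (@curvature_comparison _ (T + D)) => //.
    by rewrite appD Dx0 line_zero.
  by rewrite appD tangent_perturbation tangent_image line_scale mul1r.
have K2 : (lambda - delta) ^+ 2 * curvature q y0 (tangent q y0) <=
  curvature p x0 v0.
  apply: (@curvature_comparison _ (T - D)) => //.
    by rewrite appB Dx0 line_zero.
  by rewrite appB tangent_perturbation tangent_image line_scale mulN1r.
have cq0 := curvature_ge0 y0 q1 (tangent q y0).
have lt_curv : curvature q y0 w < curvature p x0 v0.
  rewrite /w curvature_scale.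
  set k := curvature q y0 _ in K1 K2 cq0 *.
  (* Zero curvature at [y0] means that [y0] is flat, so [x0] is not flat and its curvature is
     positive. *)
  have [k0|k0] := eqVneq k 0.
    rewrite k0 mulr0; apply: curvature_gt0 => // fx.
    have fy : flat q y0.
      apply: contrapT => nfy; have := curvature_gt0 q1 uy nsy nfy.
      by rewrite -/k k0 ltxx.
    exact: nff.
  have kp : 0 < k by rewrite lt_neqAle eq_sym k0.
  have : 0 < delta ^+ 2 * k by rewrite mulr_gt0// exprn_even_gt0.
  (* The weights 3/4 and 1/4 express lambda + delta/2 through lambda + delta and lambda - delta; the
     last term is the defect of convexity of the square. *)
  have -> : (lambda + delta / 2) ^+ 2 * k =
    3 / 4 * ((lambda + delta) ^+ 2 * k) +
      1 / 4 * ((lambda - delta) ^+ 2 * k) - 3 / 4 * (delta ^+ 2 * k) by field.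
  lra.
pose c := (curvature q y0 w + curvature p x0 v0) / 2.
have w0 := curvature_ge0 y0 q1 w.
exists c; first by rewrite divr_gt0//; lra.
by split; [apply: not_sharp_quad_low|apply: not_sharp_quad_up] => //;
  rewrite /c; lra.
Qed.

End Perturbation.

(** * Operator norm, closure and extreme contractions *)

Lemma mulmx2E (R : realType) n (A : 'M[R]_2) (B : 'M[R]_(2, n)) i j :
  (A *m B) i j = A i ord0 * B ord0 j + A i ord_max * B ord_max j.
Proof.
rewrite mxE !big_ord_recl big_ord0 addr0.
by have -> : lift ord0 ord0 = ord_max :> 'I_2 by apply: val_inj.
Qed.

Section OperatorNorm.
Variables (R : realType) (p q : R).
Hypotheses (p1 : 1 < p) (q1 : 1 < q).
Implicit Types (S T D : 'M[R]_2) (z : R * R).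

Let col (z : R * R) : 'cV[R]_2 := \col_i (if i == ord0 then z.1 else z.2).

Let lpnorm_col (r : R) z : lpnorm r (col z) = lp r z.
Proof. by rewrite /lpnorm /lp /lpsum !mxE. Qed.

Let lpnorm_mul (r : R) T (x : 'cV[R]_2) :
  lpnorm r (T *m x) = lp r (app T (x ord0 ord0, x ord_max ord0)).
Proof. by rewrite /lpnorm /lp /lpsum !mulmx2E. Qed.

Let lpnorm_mul_col (r : R) T z : lpnorm r (T *m col z) = lp r (app T z).
Proof. by rewrite lpnorm_mul !mxE /= -surjective_pairing. Qed.

Lemma le_powR_inv (r a b : R) : 1 < r -> 0 <= a -> a `^ r <= b -> a <=
  b `^ r^-1.
Proof.
move=> r1 a0 H; rewrite -[leLHS](powRK_inv r1 a0).
apply: ge0_ler_powR; rewrite ?nnegrE ?powR_ge0//;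
  last exact: le_trans (powR_ge0 _ _) H.
by rewrite invr_ge0 ltW// (lt_trans ltr01).
Qed.

Lemma norm_fst_le_lp (r : R) z : 1 < r -> `|z.1| <= lp r z.
Proof. by move=> r1; apply: le_powR_inv => //; rewrite lerDl powR_ge0. Qed.

Lemma norm_snd_le_lp (r : R) z : 1 < r -> `|z.2| <= lp r z.
Proof. by move=> r1; apply: le_powR_inv => //; rewrite lerDr powR_ge0. Qed.

Lemma opnorm_has_ubound T :
  has_ubound [set lpnorm q (T *m x) | x in [set x : 'cV[R]_2 | lpnorm p x <=
    1]].
Proof.
pose B := `|T ord0 ord0| + `|T ord0 ord_max| + (`|T ord_max ord0| + `|T ord_max
  ord_max|).
exists ((B `^ q + B `^ q) `^ q^-1) => _ [x /= xp <-].
rewrite lpnorm_mul; set z := (_, _).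
have x1 : `|z.1| <= 1 by apply: le_trans xp; exact: (norm_fst_le_lp z p1).
have x2 : `|z.2| <= 1 by apply: le_trans xp; exact: (norm_snd_le_lp z p1).
have row (a b : R) : `|a * z.1 + b * z.2| <= `|a| + `|b|.
  apply: le_trans (ler_normD _ _) _; rewrite !normrM.
  by apply: lerD; rewrite ler_piMr.
apply: ge0_ler_powR.
- by rewrite invr_ge0 ltW// (lt_trans ltr01).
- by rewrite nnegrE lpsum_ge0.
- by rewrite nnegrE addr_ge0 ?powR_ge0.
have q0 : 0 <= q by rewrite ltW// (lt_trans ltr01).
apply: lerD; apply: ge0_ler_powR; rewrite ?nnegrE ?addr_ge0//.
- by apply: le_trans (row _ _) _; rewrite lerDl addr_ge0.
- by apply: le_trans (row _ _) _; rewrite lerDr addr_ge0.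
Qed.

Lemma lp_le_opnorm T z : lp p z <= 1 -> lp q (app T z) <= opnorm p q T.
Proof.
move=> z1; apply: ub_le_sup; first exact: opnorm_has_ubound.
by exists (col z); [rewrite /= lpnorm_col; exact: z1|exact: lpnorm_mul_col].
Qed.

Lemma opnorm_le1 T : opnorm p q T <= 1 <-> contraction p q T.
Proof.
split=> [H|H].
  apply: contraction_unit => // z uz.
  have z1 : lp p z <= 1 by rewrite (lp_eq1 uz).
  by have := le_trans (lp_le_opnorm T z1) H; rewrite lp_le// powR1.
apply: ge_sup.
  exists (lpnorm q (T *m col (0, 0))), (col (0, 0)); last reflexivity.
  rewrite /= lpnorm_col lp_le// /lpsum /= normr0 powR0 ?addr0 ?powR1//.
  by rewrite gt_eqF// (lt_trans ltr01).
by move=> _ [x /= xp <-]; rewrite lpnorm_mul; apply: (le_trans (H _));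
  exact: xp.
Qed.

(** Tested on the basis vectors, this lets entrywise neighbourhoods be used for the closure in
    operator norm. *)
Lemma entry_le_opnorm T i j : `|T i j| <= opnorm p q T.
Proof.
have p0 : p != 0 by rewrite gt_eqF// (lt_trans ltr01).
have u1 : lp p (1, 0) <= 1
  by rewrite lp_le// /lpsum /= normr1 normr0 powR0// addr0 powR1.
have u2 : lp p (0, 1) <= 1
  by rewrite lp_le// /lpsum /= normr1 normr0 powR0// add0r powR1.
have [H1 H2] := (lp_le_opnorm T u1, lp_le_opnorm T u2).
have [A1 A2] := (norm_fst_le_lp (app T (1, 0)) q1, norm_snd_le_lp (app T (1,
  0)) q1).
have [B1 B2] := (norm_fst_le_lp (app T (0, 1)) q1, norm_snd_le_lp (app T (0,
  1)) q1).
rewrite /= !mulr1 !mulr0 ?addr0 ?add0r in A1 A2 B1 B2.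
case: (ord2P i) => ->; case: (ord2P j) => ->.
- exact: le_trans A1 H1.
- exact: le_trans B1 H2.
- exact: le_trans A2 H1.
- exact: le_trans B2 H2.
Qed.

Lemma opclosure_near (E : set 'M[R]_2) T (P : 'M[R]_2 -> Prop) :
  opclosure p q E T -> (\forall S \near T, P S) -> exists2 S, E S & P S.
Proof.
move=> cE /nbhs_ballP[e /= e0 eP]; have [S ES TS] := cE e e0.
exists S => //; apply: eP; split=> // i j; rewrite /ball /=.
by apply: le_lt_trans TS; have := entry_le_opnorm (T - S) i j; rewrite !mxE.
Qed.

Lemma extreme_perturbation S D : extreme_contractions p q S ->
  contraction p q (S + D) -> contraction p q (S - D) -> D = 0.
Proof.
move=> [_ H] /opnorm_le1 c1 /opnorm_le1 c2.
have [||SD _] := H (S + D) (S - D) 2^-1 c1 c2.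
- by rewrite invr_gt0 ltr0n invf_lt1 ?ltr1n ?ltr0n.
- by apply/matrixP => i j; rewrite !mxE; field.
by apply: (addrI S); rewrite SD addr0.
Qed.

Lemma extreme_contraction S : extreme_contractions p q S -> contraction p q S.
Proof. by case=> /opnorm_le1. Qed.

Lemma not_extreme_perturbation T : contraction p q T ->
  ~ extreme_contractions p q T -> exists2 D, D != 0 &
  contraction p q (T + D) /\ contraction p q (T - D).
Proof.
move=> cT nE; apply: contrapT => nD; apply: nE; split; first exact/opnorm_le1.
move=> A B t /opnorm_le1 cA /opnorm_le1 cB /andP[t0 t1] TE.
suff AB : A - B = 0.
  by have {}AB := subr0_eq AB; rewrite TE AB -scalerDl subrKC scale1r.
apply: contrapT => AB; apply: nD.
(* A step at most both barycentric weights keeps [T + m *: (A - B)] and [T - m *: (A - B)] on the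
   segment from [A] to [B]. *)
pose m := Num.min t (1 - t).
have m0 : 0 < m by rewrite /m lt_min t0 subr_gt0.
have mt : m <= t by rewrite /m ge_min lexx.
have mt' : m <= 1 - t by rewrite /m ge_min lexx orbT.
exists (m *: (A - B)); first by rewrite scaler_eq0 (gt_eqF m0); apply/eqP.
split.
- have -> : T + m *: (A - B) = (t + m) *: A + (1 - (t + m)) *: B.
    by rewrite TE; apply/matrixP => i j; rewrite !mxE; ring.
  by apply: contraction_convex => //; apply/andP; split; lra.
- have -> : T - m *: (A - B) = (t - m) *: A + (1 - (t - m)) *: B.
    by rewrite TE; apply/matrixP => i j; rewrite !mxE; ring.
  by apply: contraction_convex => //; apply/andP; split; lra.
Qed.

Lemma mx_cvg_id T : mx_cvg (nbhs T) id T.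
Proof. by move=> k l; exact: coord_continuous. Qed.

(** If the image of the sphere stayed in the open ball, compactness would leave room to add and
    subtract a small multiple of the identity. *)
Lemma extreme_attains S : extreme_contractions p q S ->
  exists2 x, lpsum p x = 1 & lpsum q (app S x) = 1.
Proof.
move=> ES; apply: contrapT => nS.
have cS := extreme_contraction ES.
have : \forall e \near (0 : R), forall z, lpsum p z = 1 ->
    lpsum q (app (S + e%:M) z) <= 1.
  apply: (@sphere_near_covering R p R (nbhs (0 : R)) _
    (fun e z => lpsum q (app (S + e%:M) z) <= 1)) => // z uz.
  pose G := filter_prod (nbhs z) (nbhs (0 : R)).
  have FG : Filter G by exact: filter_prod_filter.
  have c1 : mx_cvg G (fun j => S + (j.2)%:M) S.
    move=> k l; have c0 : (fun j : (R * R) * R => j.2) @ G --> (0 : R)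
      by exact: cvg_snd.
    have -> : (fun j : (R * R) * R => (S + (j.2)%:M) k l) =
        fun j => S k l + j.2 * (k == l)%:R.
      by apply/funext => j; rewrite !mxE mulr_natr.
    have : S k l + j.2 * (k == l)%:R @[j --> G] --> S k l + 0 * (k == l)%:R.
      by apply: cvgD; [exact: cvg_cst|apply: cvgM; [exact: c0|exact: cvg_cst]].
    by rewrite mul0r addr0.
  have c2 : cvg2 G fst z by exact: cvg2_fst.
  have l1 : lpsum q (app S z) < 1.
    rewrite lt_neqAle (contraction_lpsum p1 q1 cS uz) andbT.
    by apply/eqP => H; apply: nS; exists z.
  have /cvgr_lt/(_ _ l1) := cvg_lpsum FG q1 (@cvg_app _ _ _ FG _ _ _ _ c1 c2).
  by apply: filterS => -[z' e] /= /ltW.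
move=> /nbhs_ballP[r /= r0 Hr].
have c (e : R) : `|e| < r -> contraction p q (S + e%:M).
  by move=> er; apply: contraction_unit => // z; apply: Hr;
    rewrite /ball /= sub0r normrN.
have r2 : `|r / 2| < r by rewrite gtr0_norm ?divr_gt0//; lra.
have cN : contraction p q (S - (r / 2)%:M).
  have -> : - (r / 2)%:M = (- (r / 2))%:M :> 'M[R]_2.
    by apply/matrixP => i j; rewrite !mxE mulNrn.
  by apply: c; rewrite normrN.
have /matrixP/(_ ord0 ord0) := extreme_perturbation ES (c _ r2) cN.
rewrite !mxE eqxx mulr1n => /eqP.
by rewrite mulf_eq0 (gt_eqF r0) invr_eq0 pnatr_eq0.
Qed.

(** Near each unit [x], either the norm is not attained or both bumps are admissible. Compactness
    joins these local statements into one neighbourhood of [T]. *)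
Lemma near_not_extreme T D : contraction p q T -> D != 0 ->
  contraction p q (T + D) -> contraction p q (T - D) ->
  (forall x, lpsum p x = 1 -> lpsum q (app T x) = 1 ->
     ~ (flat p x /\ flat q (app T x)) /\ ~ (sharp p x /\ sharp q (app T x))) ->
  \forall S \near T, ~ extreme_contractions p q S.
Proof.
move=> cT D0 cD cND H.
have : \forall S \near T, forall x, lpsum p x = 1 ->
    extreme_contractions p q S -> lpsum q (app S x) <> 1.
  apply: (@sphere_near_covering R p _ (nbhs T) _
    (fun S x => extreme_contractions p q S -> lpsum q (app S x) <> 1)) =>
      // x ux.
  pose G := filter_prod (nbhs x) (nbhs T).
  have FG : Filter G by exact: filter_prod_filter.
  have c1 : mx_cvg G snd T.
    move=> k l; apply: (@cvg_comp _ _ _ snd (fun M : 'M[R]_2 =>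
      M k l) G (nbhs T)).
      exact: cvg_snd.
    exact: coord_continuous.
  have c2 : cvg2 G fst x by exact: cvg2_fst.
  have [uy|uy] := eqVneq (lpsum q (app T x)) 1; last first.
    have l1 : lpsum q (app T x) < 1.
      by rewrite lt_neqAle uy (contraction_lpsum p1 q1 cT ux).
    have /cvgr_lt/(_ _ l1) := cvg_lpsum FG q1 (@cvg_app _ _ _ FG _ _ _ _ c1 c2).
    apply: filterS => -[x' S] /= h _ _ h1.
    by rewrite h1 ltxx in h.
  have [nff nss] := H x ux uy.
  have d0 := delta_neq0 p1 q1 cD cND cT ux uy D0.
  have [c c0 [ql qu]] := quadratic_gap p1 q1 cD cND cT ux uy D0 nff nss.
  have N1 := near_bump_contraction p1 q1 cD cND cT ux uy FG d0 c0 ql qu c1 c2.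
  (* The multiplier of [- D] is the opposite of that of [D], so the second application yields the
     opposite bump. *)
  have D0' : - D != 0 by rewrite oppr_eq0.
  have cD' : contraction p q (T + - D) by [].
  have cND' : contraction p q (T - - D) by rewrite opprK.
  have d0' := delta_neq0 p1 q1 cD' cND' cT ux uy D0'.
  have [c' c0' [ql' qu']] := quadratic_gap p1 q1 cD' cND' cT ux uy D0' nff nss.
  have N2 := near_bump_contraction p1 q1 cD' cND' cT ux uy FG d0' c0' ql' qu'
    c1 c2.
  move: (@filterI _ _ FG _ _ N1 N2);
    apply: filterS => -[x' S] /= [h1 h2] ux' ES uy'.
  have cS := extreme_contraction ES.
  move: (h1 cS ux' uy') (h2 cS ux' uy').
  set d := cross _ _ in d0 *; set d' := cross _ _.
  have -> : d' = - d.
    by rewrite /d' /d /cross /app /= !mxE; ring.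
  have bumpN (e : R) (u y : R * R) :
    bump q (- e / 2) u y = - bump q (e / 2) u y.
    by apply/matrixP => i j; rewrite !mxE; ring.
  rewrite bumpN => b1 b2; have := extreme_perturbation ES b1 b2.
  move/(congr1 (fun A => app A (tangent p x'))).
  rewrite app_bump cross_tangent// ux' mulr1.
  have -> : app (0 : 'M[R]_2) (tangent p x') = (0, 0).
    by rewrite /app !mxE !mul0r addr0.
  move=> /(tangent_neq0 q1 uy') /eqP;
    rewrite mulf_eq0 (negbTE d0) invr_eq0 pnatr_eq0.
  by [].
apply: filterS => S HS ES; have [x ux uy] := extreme_attains ES.
exact: HS ux ES uy.
Qed.

Lemma opclosure_contraction T : opclosure p q (extreme_contractions p q) T ->
  contraction p q T.
Proof.
move=> cT; apply: contraction_unit => // z uz.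
rewrite leNgt; apply/negP => h.
have c2 : cvg2 (nbhs T) (fun=> z) z by split; exact: cvg_cst.
have /cvgr_gt/(_ _ h) N :=
  cvg_lpsum (nbhs_filter T) q1 (@cvg_app _ _ _ (nbhs_filter T) _ _ _ _
  (@mx_cvg_id T) c2).
have [S ES] := opclosure_near cT N.
by rewrite ltNge (contraction_lpsum p1 q1 (extreme_contraction ES) uz).
Qed.

Lemma opclosure_not_extreme T : opclosure p q (extreme_contractions p q) T ->
  ~ extreme_contractions p q T ->
  exists D x, [/\ D != 0, contraction p q (T + D), contraction p q (T - D),
    lpsum p x = 1 /\ lpsum q (app T x) = 1 &
    (flat p x /\ flat q (app T x)) \/ (sharp p x /\ sharp q (app T x))].
Proof.
move=> clT nET; have cT := opclosure_contraction clT.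
have [D D0 [cD cND]] := not_extreme_perturbation cT nET.
apply: contrapT => nx.
have N : \forall S \near T, ~ extreme_contractions p q S.
  apply: (near_not_extreme cT D0 cD cND) => x ux uy.
  by split=> h; apply: nx; exists D, x; split=> //; [left|right].
by have [S ES] := opclosure_near clT N.
Qed.

End OperatorNorm.

(** * The diagonal form at points of the axes *)

Lemma norm_lt1_midpoint (R : realType) (l d : R) :
  d != 0 -> `|l + d| <= 1 -> `|l - d| <= 1 -> `|l| < 1.
Proof.
rewrite !ler_norml ltr_norml => d0 /andP[h1 h2] /andP[h3 h4].
by case: (ltrgt0P d) d0 => // d0 _; apply/andP; split; lra.
Qed.

Section DiagonalForm.
Variables (R : realType) (p : R).
Hypothesis p1 : 1 < p.

Let p10 : 0 < p - 1. Proof. by rewrite subr_gt0. Qed.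

Lemma psi_pm1 (s : R) : s = 1 \/ s = -1 -> psi (p - 1) s = s.
Proof.
have psi1 : psi (p - 1) 1 = 1 :> R by rewrite psi_ge0E// powR1.
by case=> ->; rewrite ?psiN psi1.
Qed.

Lemma unit_coordinate (x : R * R) : lpsum p x = 1 -> x.1 = 0 \/ x.2 = 0 ->
  exists2 s, s = 1 \/ s = -1 & x = (s, 0) \/ x = (0, s).
Proof.
have p0 : 0 < p by exact: lt_trans p1.
have K (a : R) : `|a| `^ p = 1 -> a = 1 \/ a = -1.
  move=> H; have a1 : `|a| = 1.
    by have := powRK_inv p1 (normr_ge0 a); rewrite H powR1.
  by case: (ltrgt0P a) a1; [left|right|]; lra.
case: x => a b /=; rewrite /lpsum /= => + [x0|x0];
  rewrite x0 normr0 powR0 ?gt_eqF//.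
- by rewrite add0r => /K bs; exists b => //; right.
- by rewrite addr0 => /K bs; exists a => //; left.
Qed.

Lemma mx2P (A B : 'M[R]_2) :
  A ord0 ord0 = B ord0 ord0 -> A ord0 ord_max = B ord0 ord_max ->
  A ord_max ord0 = B ord_max ord0 -> A ord_max ord_max = B ord_max ord_max ->
  A = B.
Proof.
by move=> *; apply/matrixP => i j; case: (ord2P i) => ->; case: (ord2P j) => ->.
Qed.

Definition swap_mx : 'M[R]_2 := tperm_mx ord0 ord_max.

Lemma swap_mxE : [/\ swap_mx ord0 ord0 = 0, swap_mx ord0 ord_max = 1,
  swap_mx ord_max ord0 = 1 & swap_mx ord_max ord_max = 0].
Proof. by rewrite /swap_mx /tperm_mx /perm_mx !mxE !tpermL !tpermR. Qed.

Lemma diag2E (a b : R) :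
  [/\ diag2 a b ord0 ord0 = a, diag2 a b ord0 ord_max = 0,
  diag2 a b ord_max ord0 = 0 & diag2 a b ord_max ord_max = b].
Proof. by rewrite /diag2 !mxE /= ?mulr1n ?mulr0n. Qed.

Let one := 1%:M : 'M[R]_2.

Let signum_perm1 : signum_perm_product one.
Proof. by exists [::]; rewrite ?big_nil. Qed.

Let signum_perm_swap : signum_perm_product swap_mx.
Proof.
exists [:: swap_mx]; last by rewrite big_seq1.
by move=> M; rewrite inE => /eqP ->; right; exact: perm_mx_is_perm.
Qed.

Let signum_perm_sign (e : R) : e = 1 \/ e = -1 ->
  signum_perm_product (diag2 e 1).
Proof.
move=> e1; exists [:: diag2 e 1]; last by rewrite big_seq1.
by move=> M; rewrite inE => /eqP ->; left; exists e, 1; split=> //; left.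
Qed.

Let signum_permM (A B : 'M[R]_2) : signum_perm_product A ->
  signum_perm_product B -> signum_perm_product (A *m B).
Proof.
move=> [s Hs ->] [t Ht ->]; exists (s ++ t); last by rewrite big_cat.
by move=> M; rewrite mem_cat => /orP[/Hs|/Ht].
Qed.

Let diag_form (A B T : 'M[R]_2) (e s : R) : e = 1 \/ e = -1 -> `|s| < 1 ->
  signum_perm_product A -> signum_perm_product B ->
  T = A *m diag2 e s *m B ->
  exists (A B : 'M[R]_2) (s : R),
    [/\ `|s| < 1, signum_perm_product A, signum_perm_product B &
        T = A *m diag2 1 s *m B].
Proof.
move=> e1 s1 sA sB ->; exists (A *m diag2 e 1), B, s; split=> //.
  by apply: signum_permM => //; exact: signum_perm_sign.
congr (_ *m _); rewrite -mulmxA; congr (_ *m _).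
have [d1 d2 d3 d4] := diag2E e s; have [e1' e2 e3 e4] := diag2E e 1.
have [f1 f2 f3 f4] := diag2E 1 s.
by apply: mx2P; rewrite mulmx2E ?d1 ?d2 ?d3 ?d4 ?e1' ?e2 ?e3 ?e4 ?f1 ?f2 ?f3
  ?f4; ring.
Qed.

(** Unit vectors on the axes have unit tangents on the other axis, so [T] is determined by [l] up to
    signs and a choice of axes. The bounds on l + d and l - d give |l| < 1. The quarter turn in
    [tangent] contributes a minus sign exactly when [x] and its image lie on different axes. *)
Lemma coordinate_form (T D : 'M[R]_2) (x : R * R) : D != 0 ->
  contraction p p T -> contraction p p (T + D) -> contraction p p (T - D) ->
  lpsum p x = 1 -> lpsum p (app T x) = 1 ->
  x.1 = 0 \/ x.2 = 0 -> (app T x).1 = 0 \/ (app T x).2 = 0 ->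
  exists (A B : 'M[R]_2) (s : R),
    [/\ `|s| < 1, signum_perm_product A, signum_perm_product B &
        T = A *m diag2 1 s *m B].
Proof.
move=> D0 cT cD cND ux uy x0 y0.
have d0 := delta_neq0 p1 p1 cD cND cT ux uy D0.
have TE := tangent_image p1 p1 cT ux uy.
have DE := tangent_perturbation p1 p1 cD cND cT ux uy.
set d := cross _ _ in d0 DE; set l := cross _ _ in TE.
have [s s1 xE] := unit_coordinate ux x0;
  have [t t1 yE] := unit_coordinate uy y0.
have p0 : p != 0 by rewrite gt_eqF// (lt_trans ltr01).
have ut (z : R * R) (e : R) : e = 1 \/ e = -1 -> z = (e, 0) \/ z = (0, e) ->
    lp p (tangent p z) = 1.
  move=> e1 zE; apply: lp_eq1.
  have n1 : `|e| = 1 by case: e1 => ->; rewrite ?normrN normr1.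
  by case: zE => ->; rewrite /lpsum /tangent /= psi0 psi_pm1// ?oppr0 ?normrN
    normr0 n1
    powR1 powR0// ?addr0 ?add0r.
have ux' := ut _ _ s1 xE; have uy' := ut _ _ t1 yE.
have lD : `|l + d| <= 1.
  have := cD (tangent p x); rewrite appD TE DE line_scale mul1r lp_scale//.
  by rewrite ux' uy' mulr1.
have lND : `|l - d| <= 1.
  have := cND (tangent p x); rewrite appB TE DE line_scale mulN1r lp_scale//.
  by rewrite ux' uy' mulr1.
have l1 : `|l| < 1 by exact: norm_lt1_midpoint d0 lD lND.
have [P1 P2 P3 P4] := swap_mxE.
have ss : s * s = 1 by case: s1 => ->; ring.
have ts : t * s = 1 \/ t * s = -1.
  by case: s1 => ->; case: t1 => ->; rewrite ?mulr1 ?mulrN1 ?opprK; tauto.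
have lts : `|l * (t * s)| < 1.
  by case: ts => ->; rewrite ?mulrN1 ?mulr1 ?normrN.
have ltsN : `|- l * (t * s)| < 1 by rewrite mulNr normrN.
have sE (a b : R) : a * s = b -> a = b * s by move=> <-;
  rewrite -mulrA ss mulr1.
have [d1 d2 d3 d4] := diag2E (t * s) (l * (t * s)).
have [e1 e2 e3 e4] := diag2E (t * s) (- l * (t * s)).
have fin A B b : `|b| < 1 -> signum_perm_product A -> signum_perm_product B ->
    T = A *m diag2 (t * s) b *m B ->
    exists (A B : 'M[R]_2) (s : R),
    [/\ `|s| < 1, signum_perm_product A, signum_perm_product B &
        T = A *m diag2 1 s *m B].
  by move=> b1 sA sB; exact: diag_form ts b1 sA sB.
case: xE => xE; case: yE => yE; rewrite yE xE in TE; rewrite xE in yE;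
  case: yE TE; rewrite /app /tangent /scale /= psi0 ?oppr0 ?psi_pm1// !(mulr0,
    add0r, addr0) ?mulrN;
  move=> /sE y1 /sE y2.
- case=> /sE y3 /sE y4; apply: (fin _ _ _ lts signum_perm1 signum_perm1).
  rewrite mulmx1 mul1mx; apply: mx2P; rewrite ?d1 ?d2 ?d3 ?d4 ?y1 ?y2 ?y3 ?y4;
    ring.
- case=> /sE y3 /sE y4; apply: (fin _ _ _ ltsN signum_perm_swap signum_perm1).
  rewrite mulmx1; apply: mx2P;
    rewrite mulmx2E ?P1 ?P2 ?P3 ?P4 ?e1 ?e2 ?e3 ?e4 ?y1 ?y2 ?y3 ?y4; ring.
- move=> [/eqP h3 /eqP h4].
  have /sE y3 : T ord0 ord0 * s = 0 by apply/eqP; rewrite -oppr_eq0.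
  have /sE y4 : T ord_max ord0 * s = - (l * t) by apply/eqP; rewrite -eqr_oppLR.
  apply: (fin _ _ _ ltsN signum_perm1 signum_perm_swap).
  rewrite mul1mx; apply: mx2P;
    rewrite mulmx2E ?P1 ?P2 ?P3 ?P4 ?e1 ?e2 ?e3 ?e4 ?y1 ?y2 ?y3 ?y4; ring.
- move=> [/oppr_inj/sE y3 /eqP h4].
  have /sE y4 : T ord_max ord0 * s = 0 by apply/eqP; rewrite -oppr_eq0.
  apply: (fin _ _ _ lts signum_perm_swap signum_perm_swap).
  apply: mx2P; rewrite !mulmx2E ?P1 ?P2 ?P3 ?P4 ?d1 ?d2 ?d3 ?d4 ?y1 ?y2 ?y3
    ?y4; ring.
Qed.

End DiagonalForm.

Theorem theorem4p1 (R : realType) (p q : R) (hp : 1 < p) (hq : 1 < q) :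
  ([\/ p = 2 /\ q = 2,
       p = 2 /\ q <> 2,
       p <> 2 /\ q = 2 |
       q < 2 /\ 2 < p] ->
     opclosed p q (extreme_contractions p q)) /\
  (p = q -> p <> 2 ->
     forall T : 'M[R]_2,
       opclosure p p (extreme_contractions p p) T ->
       ~ extreme_contractions p p T ->
       exists (A B : 'M[R]_2) (s : R),
         [/\ `|s| < 1, signum_perm_product A, signum_perm_product B &
             T = A *m diag2 1 s *m B]).
Proof.
split=> [pq T clT|_ _ T clT nET].
  apply: contrapT => nET.
  have [D [x [_ _ _ _ H]]] := opclosure_not_extreme hp hq clT nET.
  (* Flatness or sharpness on both sides puts both exponents strictly on the same side of 2, which
     each of the four cases excludes. *)
  have [[p2 q2]|[p2 q2]] : (2 < p /\ 2 < q) \/ (p < 2 /\ q < 2).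
    by case: H => -[[? _] [? _]]; [left|right].
  - by case: pq => -[]; lra.
  - by case: pq => -[]; lra.
have [D [x [D0 cD cND [ux uy] H]]] := opclosure_not_extreme hp hp clT nET.
have cT := opclosure_contraction hp hp clT.
by apply: (coordinate_form hp D0 cT cD cND ux uy); case: H => -[[_ ?] [_ ?]].
Qed.
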